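(* Let $N\ge 1$. The function $\mathfrak{h}_N(x)=\mathfrak{h}_N(x;\lambda)$ on $\mathbb{W}^N$ is a positive harmonic function for the semigroup $(\mathcal{P}_t^N;t\ge0)$, i.e. $\mathfrak h_N>0$ and $\sum_{y\in\mathbb{W}^N}\mathcal{P}_t^N(x,y)\mathfrak{h}_N(y)=\mathfrak{h}_N(x)$ for all $t\ge 0$, $x\in\mathbb{W}^N$. Moreover, the function $\mathfrak{h}_{(N,N+1)}$ on $\mathbb{W}^{N,N+1}$ defined by $\mathfrak{h}_{(N,N+1)}((y,x);\lambda)=\mathfrak{h}_N(y;\lambda)$ is a positive harmonic function for the semigroup $(\mathsf{U}_t^{N,N+1};t\ge0)$.
   Context: $\mathbb{Z}_+=\{0,1,2,\dots\}$ and $\lambda:\mathbb{Z}_+\to(0,\infty)$ satisfies $0<\inf\lambda\le\sup\lambda<\infty$. Let $[\nabla^+f](x)=f(x+1)-f(x)$, $[\nabla^-f](x)=f(x-1)-f(x)$ (a subscript indicates the variable acted on), $\mathsf{L}=\lambda(x)\nabla^+_x$ the generator of the pure-birth chain on $\mathbb{Z}_+$ jumping from $x$ to $x+1$ at rate $\lambda(x)$, $e^{t\mathsf{L}}(x,y)$ its transition probability from $x$ to $y$ in time $t$, and $e^{t\mathsf{L}}\mathbf{1}_{[\![0,y]\!]}(x)=\sum_{z=0}^{y}e^{t\mathsf{L}}(x,z)$ (equal to $0$ if $y=-1$). $\mathbb{W}^N=\{x\in\mathbb{Z}_+^N:x_1<\dots<x_N\}$; for $y\in\mathbb{W}^N,x\in\mathbb{W}^{N+1}$,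 $y\prec x$ means $x_1\le y_1<x_2\le\dots<x_N\le y_N<x_{N+1}$; $\mathbb{W}^{N,N+1}=\{(y,x)\in\mathbb{Z}_+^{N}\times\mathbb{Z}_+^{N+1}:x_1\le y_1<x_2\le\dots\le y_N<x_{N+1}\}$. $\mathfrak{h}_1\equiv1$ and $\mathfrak{h}_{N+1}(x)=\sum_{y\in\mathbb{W}^N,\,y\prec x}\prod_{i=1}^N\lambda(y_i)^{-1}\,\mathfrak{h}_N(y)$ for $x\in\mathbb{W}^{N+1}$. Karlin–McGregor sub-Markov semigroup: $\mathcal{P}_t^N(x,y)=\det(e^{t\mathsf{L}}(x_i,y_j))_{i,j=1}^N$, $x,y\in\mathbb{W}^N$. Two-level kernel: for $(y,x),(y',x')\in\mathbb{W}^{N,N+1}$, $$\mathsf{U}_t^{N,N+1}[(y,x),(y',x')]=\det\begin{pmatrix}\mathsf{A}_t(x,x')&\mathsf{B}_t(x,y')\\ \mathsf{C}_t(y,x')&\mathsf{D}_t(y,y')\end{pmatrix},$$ a determinant of size $2N+1$ with blocks of sizes $(N+1)\times(N+1)$, $(N+1)\times N$, $N\times(N+1)$, $N\times N$ and entries $\mathsf{A}_t(x,x')_{ij}=e^{t\mathsf{L}}(x_i,x'_j)$; $\mathsf{B}_t(x,y')_{ij}=\lambda(y'_j)^{-1}\big(e^{t\mathsf{L}}\mathbf{1}_{[\![0,y'_j]\!]}(x_i)-\mathbf{1}(j\ge i)\big)$; $\mathsf{C}_t(y,x')_{ij}=\lambda(y_i)\nabla^+_{y_i}\nabla^-_{x'_j}e^{t\mathsf{L}}\mathbf{1}_{[\![0,x'_j]\!]}(y_i)$;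 $\mathsf{D}_t(y,y')_{ij}=e^{t\mathsf{L}}(y_i,y'_j)$. Harmonicity of $h$ for $(\mathsf{U}_t^{N,N+1})$ means $\sum_{(y',x')}\mathsf{U}_t^{N,N+1}[(y,x),(y',x')]h(y',x')=h(y,x)$ for all $t\ge0$ and $(y,x)\in\mathbb{W}^{N,N+1}$. *)

(* Defs.v *)
From HB Require Import structures.
From mathcomp Require Import all_boot all_order all_algebra finmap.
From mathcomp Require Import all_classical all_reals all_analysis.
From mathcomp Require Import ring.
From mathcomp.analysis.showcase Require summability.

Set Implicit Arguments.
Unset Strict Implicit.
Unset Printing Implicit Defensive.

Import Order.TTheory GRing.Theory Num.Theory numFieldNormedType.Exports.

Local Open Scope classical_set_scope.
Local Open Scope ring_scope.

(* Unordered sum: limit of the finite partial sums along the directed set of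
   finite subsets of the index type. *)
Definition has_sum (R : realType) (I : choiceType) (u : I -> R) (s : R) : Prop :=
  (fun A : {fset I} => \sum_(i <- A) u i) @ @summability.totally I --> s.

Section Chambers.

(* Coordinates are numbered from 0. *)
Definition config (N : nat) := {ffun 'I_N -> nat}.

Definition in_weyl (N : nat) (x : config N) : bool :=
  [forall i : 'I_N, forall j : 'I_N, (i < j)%N ==> (x i < x j)%N].

Definition weyl (N : nat) := {x : config N | in_weyl x}.

Definition interlace (N : nat) (y : config N) (x : config N.+1) : bool :=
  [forall i : 'I_N,
     (x (widen_ord (leqnSn N) i) <= y i)%N && (y i < x (lift ord0 i))%N].

Definition weyl2 (N : nat) :=
  {z : config N * config N.+1 | interlace z.1 z.2}.

End Chambers.

Section PureBirth.
Variables (R : realType) (lam : nat -> R).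

Definition nablaP (f : nat -> R) (x : nat) : R := f x.+1 - f x.

(* Over int, since the backward difference is also taken at 0. *)
Definition nablaM (f : int -> R) (x : int) : R := f (x - 1) - f x.

Definition gen (f : nat -> R) (x : nat) : R := lam x * nablaP f x.

(* As lam is bounded, gen is a bounded operator on bounded functions and the
   Markov semigroup it generates is its exponential series. *)
Definition expgen (t : R) (f : nat -> R) (x : nat) : R :=
  limn (series (fun n => t ^+ n / n`!%:R * iter n gen f x)).

Definition trans (t : R) (x y : nat) : R :=
  expgen t (fun z => (z == y)%:R) x.

(* e^{tL} 1_{[0,y]}(x), with value 0 at y = -1. *)
Definition cumul (t : R) (x : nat) (y : int) : R :=
  if y is Posz n then \sum_(0 <= z < n.+1) trans t x z else 0.

(* The value at N = 0 is a dummy. The sum has finite support, see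
   finite_interlace. *)
Fixpoint hfun (N : nat) : config N -> R :=
  match N with
  | 0 => fun=> 1
  | N'.+1 =>
    if N' == 0%N then fun=> 1
    else fun x =>
      \sum_(y \in [set y : config N' | in_weyl y /\ interlace y x])
        (\prod_(i < N') (lam (y i))^-1 * hfun y)
  end.

Definition KM (N : nat) (t : R) (x y : weyl N) : R :=
  \det (\matrix_(i < N, j < N) trans t (val x i) (val y j)).

Definition blockA (N : nat) (t : R) (x x' : config N.+1) : 'M[R]_N.+1 :=
  \matrix_(i, j) trans t (x i) (x' j).

Definition blockB (N : nat) (t : R) (x : config N.+1) (y' : config N) :
    'M[R]_(N.+1, N) :=
  \matrix_(i, j)
    ((lam (y' j))^-1 * (cumul t (x i) (y' j)%:Z - (i <= j)%N%:R)).

Definition blockC (N : nat) (t : R) (y : config N) (x' : config N.+1) :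
    'M[R]_(N, N.+1) :=
  \matrix_(i, j)
    (lam (y i) *
     nablaP (fun u => nablaM (fun v => cumul t u v) (x' j)%:Z) (y i)).

Definition blockD (N : nat) (t : R) (y y' : config N) : 'M[R]_N :=
  \matrix_(i, j) trans t (y i) (y' j).

Definition Ukernel (N : nat) (t : R) (z z' : weyl2 N) : R :=
  let: (y, x) := val z in
  let: (y', x') := val z' in
  \det (block_mx (blockA t x x') (blockB t x y')
                 (blockC t y x') (blockD t y y')).

Definition h1 (N : nat) (x : weyl N) : R := hfun (val x).

Definition h2 (N : nat) (z : weyl2 N) : R := hfun (val z).1.

End PureBirth.

Definition positive_harmonic (R : realType) (T : choiceType)
    (K : R -> T -> T -> R) (h : T -> R) : Prop :=
  (forall x, 0 < h x) /\
  (forall t, 0 <= t -> forall x, has_sum (fun y => K t x y * h y) (h x)).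

Lemma finite_interlace (N : nat) (x : config N.+1) :
  finite_set [set y : config N | in_weyl y /\ interlace y x].
Proof.
pose M := (\max_i x i).+1.
pose f (g : {ffun 'I_N -> 'I_M}) : config N := [ffun i => g i : nat].
apply: (@sub_finite_set _ _ (f @` setT)); last exact/finite_image/finite_finset.
move=> y [_ /forallP xy].
have ltM i : (y i < M)%N.
  have /andP[_ lt_yx] := xy i.
  by rewrite ltnS (leq_trans (ltnW lt_yx))// (leq_bigmax (lift ord0 i)).
by exists [ffun i => Ordinal (ltM i)] => //; apply/ffunP => i; rewrite !ffunE.
Qed.

Lemma is_cvg_expgen (R : realType) (lam : nat -> R) (M B : R) (f : nat -> R) :
  (forall x, `|lam x| <= M) -> (forall x, `|f x| <= B) ->
  forall t x, cvgn (series (fun n => t ^+ n / n`!%:R * iter n (gen lam) f x)).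
Proof.
move=> lamM fB t x.
have M0 : 0 <= M by apply: le_trans (lamM 0).
have B0 : 0 <= B by apply: le_trans (fB 0).
have it n : forall u, `|iter n (gen lam) f u| <= (M * 2) ^+ n * B.
  elim: n => [|n IHn] u; first by rewrite expr0 mul1r.
  rewrite iterS /gen /nablaP normrM exprS.
  rewrite [leRHS](_ : _ = M * ((M * 2) ^+ n * B + (M * 2) ^+ n * B)); last by ring.
  by rewrite ler_pM// (le_trans (ler_normB _ _))// lerD.
apply: normed_cvg.
have := @is_cvg_series_exp_coeff R (`|t| * (M * 2)).
move=> /(@is_cvg_seriesZ _ _ B); apply: series_le_cvg => n //=.
- by rewrite mulr_ge0// /exp_coeff divr_ge0 ?exprn_ge0 ?mulr_ge0.
- rewrite normrM normrM normrX normfV normr_nat.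
  rewrite [leRHS](_ : _ = `|t| ^+ n / n`!%:R * ((M * 2) ^+ n * B)); last first.
    rewrite [LHS](_ : _ = B * ((`|t| * (M * 2)) ^+ n / n`!%:R))//.
    by rewrite (exprMn n `|t|); ring.
  by rewrite ler_wpM2l// divr_ge0 ?exprn_ge0.
Qed.

(* Main.v *)
Require Import Defs.
From mathcomp Require Import all_boot all_order all_algebra finmap.
From mathcomp Require Import all_classical all_reals all_analysis.
From mathcomp Require Import fingroup perm ring lra zify.
Import Order.TTheory GRing.Theory Num.Theory numFieldNormedType.Exports.
Local Open Scope classical_set_scope.
Local Open Scope ring_scope.

Set Implicit Arguments.
Unset Strict Implicit.
Unset Printing Implicit Defensive.

(**
Put phi_0 = 1 and phi_(j+1)(x) = sum_(z < x) phi_j(z) / lambda(z), so that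
L phi_(j+1) = phi_j and L phi_0 = 0.  By multilinearity of the determinant the
recursion for h_N becomes h_N(x) = det (phi_j(x_i)), and
e^(tL) phi_j = sum_k t^k/k! phi_(j-k).  The Cauchy-Binet formula then gives
  sum_y det (e^(tL)(x_i, y_j)) det (phi_j(y_i)) = det ((e^(tL) phi_j)(x_i)),
which differs from det (phi_j(x_i)) by a unitriangular factor only.

For the two-level kernel, each x'_j ranges, for fixed y', over an interval
determined by y', so U can be summed over x' column by column.  The forward
equation L 1_[0,b] = - lambda(b) 1_b allows column operations that annihilate
the lower right block, and the sum of U over x' is seen to be P_t(y, y').  The
second claim thus reduces to the first.

All sums converge absolutely: e^(tL)(x, y) = O(K^-y) for every K > 0, whereas
h_N(y) = O(prod_i 2^(y_i)).
*)

(** * Determinants *)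

Section Determinants.
Variable R : comNzRingType.

(** In the Leibniz formula each of the first rows contributes one factor, and a product of sums is a
    sum over choice functions [g]. The rows of [W] stay fixed. *)
Lemma det_col_mx_sum p q (K : finType) (Q : 'I_p -> pred K)
    (a : 'I_p -> K -> 'I_(p + q) -> R) (W : 'M[R]_(q, p + q)) :
  \sum_(g : {ffun 'I_p -> K} | g \in family Q)
     \det (col_mx (\matrix_(i, j) a i (g i) j) W) =
  \det (col_mx (\matrix_(i, j) \sum_(k | Q i k) a i k j) W).
Proof.
rewrite exchange_big /=; apply: eq_bigr => s _.
rewrite -big_distrr /=; congr (_ * _).
rewrite big_split_ord /=.
under [X in _ = _ * X]eq_bigr => i _ do rewrite col_mxEd.
under [X in _ = X * _]eq_bigr => i _ do rewrite col_mxEu mxE.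
rewrite bigA_distr_big_dep mulr_suml; apply: eq_bigr => g _.
rewrite big_split_ord /=; congr (_ * _); apply: eq_bigr => i _.
  by rewrite col_mxEu mxE.
by rewrite col_mxEd.
Qed.

Lemma det_row_mx_sum p q (K : finType) (Q : 'I_p -> pred K)
    (v : K -> 'I_(p + q) -> R) (W : 'M[R]_(p + q, q)) :
  \sum_(g : {ffun 'I_p -> K} | g \in family Q)
     \det (row_mx (\matrix_(i, j) v (g j) i) W) =
  \det (row_mx (\matrix_(i, j) \sum_(k | Q j k) v k i) W).
Proof.
rewrite -det_tr tr_row_mx.
pose a (j : 'I_p) k i := v k i.
have -> : (\matrix_(i, j) \sum_(k | Q j k) v k i)^T =
    \matrix_(j < p, i < p + q) \sum_(k | Q j k) a j k i.
  by apply/matrixP => i j; rewrite !mxE.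
rewrite -det_col_mx_sum; apply: eq_bigr => g _.
rewrite -det_tr tr_row_mx; congr (\det (col_mx _ _)).
by apply/matrixP => i j; rewrite !mxE.
Qed.

Lemma det_mx_sum p (K : finType) (Q : 'I_p -> pred K) (a : 'I_p -> K -> 'I_p -> R) :
  \sum_(g : {ffun 'I_p -> K} | g \in family Q) \det (\matrix_(i, j) a i (g i) j) =
  \det (\matrix_(i, j) \sum_(k | Q i k) a i k j).
Proof.
rewrite exchange_big /=; apply: eq_bigr => s _.
rewrite -big_distrr /=; congr (_ * _).
under [RHS]eq_bigr => i _ do rewrite mxE.
rewrite bigA_distr_big_dep; apply: eq_bigr => g _; apply: eq_bigr => i _.
by rewrite mxE.
Qed.

Lemma det_scale_rows p (c : 'I_p -> R) (A : 'I_p -> 'I_p -> R) :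
  \det (\matrix_(i, j) (c i * A i j)) = \prod_i c i * \det (\matrix_(i, j) A i j).
Proof.
rewrite /determinant mulr_sumr; apply: eq_bigr => s _.
rewrite mulrCA -big_split /=; congr (_ * _).
by apply: eq_bigr => i _; rewrite !mxE.
Qed.

Lemma det_scale_cols p (c : 'I_p -> R) (A : 'I_p -> 'I_p -> R) :
  \det (\matrix_(i, j) (c j * A i j)) = \prod_i c i * \det (\matrix_(i, j) A i j).
Proof.
rewrite -det_tr -[\det (\matrix_(i, j) A i j)]det_tr.
have -> : (\matrix_(i, j) A i j)^T = \matrix_(i, j) A j i.
  by apply/matrixP => i j; rewrite !mxE.
by rewrite -det_scale_rows; congr (\det _); apply/matrixP => i j; rewrite !mxE.
Qed.

(** Such maps encode the [p]-element subsets of ['I_m], which index the minors in the Cauchy-Binet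
    formula. *)
Definition increasing_ffun p m (g : {ffun 'I_p -> 'I_m}) : bool :=
  [forall i : 'I_p, forall j : 'I_p, (i < j)%N ==> (g i < g j)%N].

Lemma increasing_ffunP p m (g : {ffun 'I_p -> 'I_m}) :
  reflect (forall i j : 'I_p, (i < j)%N -> (g i < g j)%N) (increasing_ffun g).
Proof.
apply: (iffP forallP) => [H i j ij|H i]; last by apply/forallP => j; apply/implyP/H.
by have /forallP/(_ j)/implyP/(_ ij) := H i.
Qed.

Definition permute_ffun p m (g : {ffun 'I_p -> 'I_m}) (s : 'S_p) :
  {ffun 'I_p -> 'I_m} := [ffun i => g (s i)].

Lemma increasing_ffun_inj p m (g : {ffun 'I_p -> 'I_m}) :
  increasing_ffun g -> injective g.
Proof.
move=> /increasing_ffunP gi i j gij.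
have [/gi|/gi|eij] := ltngtP (i : nat) j; last exact: ord_inj.
  by rewrite gij ltnn.
by rewrite gij ltnn.
Qed.


(** Sorting the tuple of values gives weak monotonicity along a permutation; injectivity makes it
    strict. *)
Lemma sorting_perm_exists p m (g : {ffun 'I_p -> 'I_m}) : injective g ->
  exists s, increasing_ffun (permute_ffun g s).
Proof.
(* For [m = 0] the domain is empty; otherwise [ord0] is available as the default of [nth]. *)
move=> gI; case: m => [|m] in g gI *.
  exists 1%g; apply/increasing_ffunP => i; by case: (g i).
pose r := fun a b : 'I_m.+1 => (a <= b)%N.
pose e := sort r [tuple g i | i < p].
have pe : perm_eq e [tuple g i | i < p] by rewrite perm_sort.
have ue : uniq e.
  by rewrite (perm_uniq pe) map_inj_uniq// enum_uniq.
have se : sorted r e by apply: sort_sorted => a b; apply: leq_total.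
have /tuple_permP[s es] := pe; exists s; apply/increasing_ffunP => i j ij.
have sz : size e = p by rewrite (perm_size pe) size_tuple.
have nthe (k : 'I_p) : nth ord0 e k = g (s k).
  by rewrite es -tnth_nth !tnth_mktuple.
have r_trans : transitive r by move=> a b c; apply: leq_trans.
have := @sorted_ltn_nth _ r r_trans ord0 e se i j.
rewrite !inE sz !ltn_ord => /(_ isT isT ij); rewrite !nthe !ffunE /r leq_eqVlt.
case/orP=> // /eqP/val_inj/gI/perm_inj eij.
by rewrite eij ltnn in ij.
Qed.

Lemma permute_ffunK p m (s : 'S_p) :
  cancel (@permute_ffun p m ^~ s) (@permute_ffun p m ^~ s^-1%g).
Proof. by move=> g; apply/ffunP => i; rewrite !ffunE permKV. Qed.

(** Both rearrangements list the same values in strictly increasing order, hence are the same list,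
    and [g] is injective. *)
Lemma sorting_perm_uniq p m (g : {ffun 'I_p -> 'I_m}) (s u : 'S_p) :
  increasing_ffun (permute_ffun g s) -> increasing_ffun (permute_ffun g u) ->
  s = u.
Proof.
move=> gs gu.
have gI : injective g.
  move=> i j gij.
  have := increasing_ffun_inj gs (x1 := (s^-1)%g i) (x2 := (s^-1)%g j).
  by rewrite !ffunE !permKV => /(_ gij)/perm_inj.
have srt w : increasing_ffun (permute_ffun g w) ->
    sorted ltn [seq nat_of_ord (permute_ffun g w i) | i <- enum 'I_p].
  move=> /increasing_ffunP gw; rewrite sorted_map.
  have : sorted ltn (map val (enum 'I_p)) by rewrite val_enum_ord iota_ltn_sorted.
  by rewrite sorted_map; apply: sub_sorted => i j /gw.
have mem w : [seq nat_of_ord (permute_ffun g w i) | i <- enum 'I_p] =i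
     [seq nat_of_ord (g i) | i <- enum 'I_p].
  move=> k; apply/mapP/mapP => -[i _ ->].
    by exists (w i); rewrite ?mem_enum ?ffunE.
  by exists ((w^-1)%g i); rewrite ?mem_enum ?ffunE ?permKV.
have E := irr_sorted_eq ltn_trans ltnn (srt _ gs) (srt _ gu)
  (fun k => etrans (mem s k) (esym (mem u k))).
apply/permP => i; apply: gI; apply: val_inj.
have /eq_in_map/(_ i) := E.
by rewrite mem_enum !ffunE => /(_ isT).
Qed.

Lemma cauchy_binet p m (A : 'I_p -> 'I_m -> R) (B : 'I_m -> 'I_p -> R) :
  \det (\matrix_(i, j) \sum_k A i k * B k j) =
  \sum_(g : {ffun 'I_p -> 'I_m} | increasing_ffun g)
    \det (\matrix_(i, j) A i (g j)) * \det (\matrix_(i, j) B (g i) j).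
Proof.
rewrite -(@det_mx_sum p _ (fun=> xpredT) (fun i k j => A i k * B k j)).
pose f (g : {ffun 'I_p -> 'I_m}) :=
  \prod_i A i (g i) * \det (\matrix_(i, j) B (g i) j).
(* An injective [g] is sorted by exactly one permutation; the other [g]
   contribute 0. *)
transitivity (\sum_(g : {ffun 'I_p -> 'I_m})
    \sum_(s : 'S_p | increasing_ffun (permute_ffun g s^-1%g)) f g).
  apply: eq_big => [g|g _]; first by apply/familyP.
  rewrite (det_scale_rows (fun i => A i (g i)) (fun i j => B (g i) j)) -/(f g).
  have [/injectiveP gI|] := boolP (injectiveb g).
    have [s gs] := sorting_perm_exists gI.
    rewrite (big_pred1 s^-1%g) // => u /=; apply/idP/eqP => [gu|->].
      by rewrite (sorting_perm_uniq gs gu) invgK.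
    by rewrite invgK.
  case/injectivePn => i [j ij gij].
  have -> : f g = 0; last by rewrite big1.
  rewrite /f (determinant_alternate ij) ?mulr0 // => k.
  by rewrite !mxE gij.
rewrite (exchange_big_dep xpredT) //=.
transitivity (\sum_(s : 'S_p)
    \sum_(h : {ffun 'I_p -> 'I_m} | increasing_ffun h) f (permute_ffun h s)).
  apply: eq_bigr => s _.
  rewrite (reindex_onto (@permute_ffun p m ^~ s) (@permute_ffun p m ^~ s^-1%g)).
    by apply: eq_bigl => h; rewrite permute_ffunK eqxx andbT.
  by move=> g _; have := permute_ffunK s^-1%g g; rewrite invgK.
rewrite exchange_big /=; apply: eq_bigr => h _.
rewrite [in RHS]/determinant mulr_suml; apply: eq_bigr => s _.
rewrite /f.
(* Permuting the rows yields the sign of [s]; with the product of entries of [A] it forms the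
   Leibniz term of [s] in the minor of [A]. *)
have -> : \matrix_(i, j) B (permute_ffun h s i) j =
    row_perm s (\matrix_(i, j) B (h i) j).
  by apply/matrixP => i j; rewrite !mxE ffunE.
rewrite row_permE det_mulmx det_perm mulrCA mulrA; congr (_ * _ * _).
by apply: eq_bigr => i _; rewrite mxE ffunE.
Qed.
End Determinants.

(** * Differences of consecutive rows and columns *)

Section Bidiagonal.
Variable R : comNzRingType.

(** Multiplication on the left subtracts from each row the preceding one; on the right it subtracts
    from each column the following one. *)
Definition bidiag n : 'M[R]_n :=
  \matrix_(i, j) ((i == j)%:R - (i == j.+1 :> nat)%:R).

Lemma det_bidiag n : \det (bidiag n) = 1.
Proof.
rewrite det_trig; last first.
  apply/is_trig_mxP => i j ij; rewrite mxE -val_eqE /= ltn_eqF // ltn_eqF ?subrr //.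
  exact: leqW.
by rewrite big1 // => i _; rewrite mxE eqxx ltn_eqF // subr0.
Qed.

Lemma bidiag_mul n m (A : 'M[R]_(n, m)) i j :
  (bidiag n *m A) i j = A i j - \sum_(k < n) (i == k.+1 :> nat)%:R * A k j.
Proof.
rewrite mxE; under eq_bigr do rewrite mxE mulrBl.
rewrite big_split /= sumrN (bigD1 i) //= eqxx mul1r big1 ?addr0 // => k ki.
by rewrite eq_sym (negbTE ki) mul0r.
Qed.

Lemma bidiag_mulS n m (A : 'M[R]_(n.+1, m)) i j :
  (bidiag n.+1 *m A) (lift ord0 i) j =
  A (lift ord0 i) j - A (widen_ord (leqnSn n) i) j.
Proof.
rewrite bidiag_mul (bigD1 (widen_ord (leqnSn n) i)) //= eqxx mul1r big1 ?addr0 //.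
move=> k; rewrite -val_eqE /= => ki.
by rewrite /bump leq0n add1n eqSS eq_sym (negbTE ki) mul0r.
Qed.

Lemma bidiag_mul0 n m (A : 'M[R]_(n.+1, m)) j :
  (bidiag n.+1 *m A) ord0 j = A ord0 j.
Proof. by rewrite bidiag_mul big1 ?subr0 // => k _; rewrite mul0r. Qed.

Lemma mul_bidiag n m (A : 'M[R]_(m, n)) i j :
  (A *m bidiag n) i j = A i j - \sum_(k < n) A i k * (k == j.+1 :> nat)%:R.
Proof.
rewrite mxE; under eq_bigr do rewrite mxE mulrBr.
rewrite big_split /= sumrN (bigD1 j) //= eqxx mulr1 big1 ?addr0 // => k ki.
by rewrite (negbTE ki) mulr0.
Qed.

Lemma mul_bidiagS n m (A : 'M[R]_(m, n.+1)) i (j : 'I_n) :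
  (A *m bidiag n.+1) i (widen_ord (leqnSn n) j) =
  A i (widen_ord (leqnSn n) j) - A i (lift ord0 j).
Proof.
rewrite mul_bidiag (bigD1 (lift ord0 j)) //= eqxx mulr1 big1 ?addr0 //.
move=> k; rewrite -val_eqE /= /bump leq0n add1n => ki.
by rewrite (negbTE ki) mulr0.
Qed.

Lemma mul_bidiag_max n m (A : 'M[R]_(m, n.+1)) i :
  (A *m bidiag n.+1) i ord_max = A i ord_max.
Proof.
rewrite mul_bidiag big1 ?subr0 // => k _.
by rewrite ltn_eqF ?mulr0 //= ltn_ord.
Qed.

(** Subtracting from each row the preceding one reduces the column of ones to its top entry, and the
    determinant to the complementary block. *)
Lemma det_first_differences n (A : 'M[R]_n.+1) :
  (forall i, A i ord0 = 1) ->
  \det A = \det (\matrix_(i < n, j < n)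
     (A (lift ord0 i) (lift ord0 j) - A (widen_ord (leqnSn n) i) (lift ord0 j))).
Proof.
move=> A1; rewrite -[LHS]mul1r -(det_bidiag n.+1) -det_mulmx.
have dlE (M : 'M[R]_(1 + n)) i j : dlsubmx M i j = M (lift ord0 i) ord0.
  by rewrite !mxE ord1; congr (M _ _); apply: val_inj.
have drE (M : 'M[R]_(1 + n)) i j : drsubmx M i j = M (lift ord0 i) (lift ord0 j).
  by rewrite !mxE; congr (M _ _); apply: val_inj.
have ulE (M : 'M[R]_(1 + n)) i j : ulsubmx M i j = M ord0 ord0.
  by rewrite !mxE !ord1; congr (M _ _); apply: val_inj.
rewrite -[bidiag _ *m A](@submxK _ 1 n 1 n).
set M := bidiag n.+1 *m A.
have -> : @dlsubmx _ 1 n 1 n M = 0.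
  by apply/matrixP => i j; rewrite dlE bidiag_mulS !A1 subrr mxE.
rewrite (@det_ublock _ 1 n) det_mx11 ulE bidiag_mul0 A1 mul1r.
by congr (\det _); apply/matrixP => i j; rewrite drE bidiag_mulS mxE.
Qed.

End Bidiagonal.

(** * The block determinant behind the two-level kernel *)

Section BlockDeterminant.
Variables (R : fieldType) (n : nat).

(** Because of the zero corner, combinations of the columns through [W] can be added to [E] without
    disturbing [C], which turns [E] into [E']. Clearing [W = E' *m Y] then leaves [- (C *m Y)] in
    the corner. *)
Lemma det_block_drzero (m1 m2 : nat) (E E' : 'M[R]_m1) (W : 'M[R]_(m1, m2))
    (C : 'M[R]_(m2, m1)) (X : 'M[R]_(m2, m1)) (Y : 'M[R]_(m1, m2)) :
  E + W *m X = E' -> W = E' *m Y ->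
  \det (block_mx E W C 0) = \det E' * \det (- (C *m Y)).
Proof.
move=> EX WY.
have -> : block_mx E W C 0 =
    block_mx E' 0 C (- (C *m Y)) *m block_mx 1%:M Y 0 1%:M *m
    block_mx 1%:M 0 (- X) 1%:M.
  rewrite !mulmx_block !mulmx1 !mul0mx !mulmx0 !addr0 !add0r.
  rewrite -WY subrr ?mul0mx ?addr0; congr block_mx.
  by rewrite mulmxN -EX addrK.
by rewrite !det_mulmx det_ublock !det_lblock !det1 !mulr1.
Qed.

(** Abstract form of the two-level kernel summed over x': [T] and [C] are the halves of the matrix
    of tail sums, [l] the rates, [P] the block of transition probabilities. Column operations undo
    the differences and cancel [P]; it comes back through [C], and the products of the [l j] and of
    their inverses cancel. *)
Lemma det_telescoped_block (T : 'M[R]_n.+1) (C : 'M[R]_(n, n.+1)) (P : 'M[R]_n)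
    (l : 'I_n -> R) :
  (forall j, l j != 0) -> (forall i, T i ord0 = 1) -> (forall i, C i ord0 = 0) ->
  (forall i j, C i (lift ord0 j) = - (l j * P i j)) ->
  \det (block_mx (T *m bidiag R n.+1)
          (\matrix_(i, j) ((l j)^-1 * (1 - T i (lift ord0 j) - (i <= j)%N%:R)))
          (C *m bidiag R n.+1) P) = \det P.
Proof.
move=> l0 T1 C0 CP.
(* [L] drops the first column and divides the others by the rates, so that [- (C *m L) = P]. *)
pose L : 'M[R]_(n.+1, n) := \matrix_(i, j) ((i == lift ord0 j)%:R * (l j)^-1).
have mulL m (A : 'M[R]_(m, n.+1)) i j : (A *m L) i j = A i (lift ord0 j) * (l j)^-1.
  rewrite mxE (bigD1 (lift ord0 j)) //= mxE eqxx mul1r big1 ?addr0 // => k kj.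
  by rewrite mxE (negbTE kj) mul0r mulr0.
(* What remains of the upper right block once the entries of [T] are removed: one minus the
   indicator of [i <= j]. *)
pose W : 'M[R]_(n.+1, n) := \matrix_(i, j) ((l j)^-1 * (j < i)%N%:R).
have -> : block_mx (T *m bidiag R n.+1)
    (\matrix_(i, j) ((l j)^-1 * (1 - T i (lift ord0 j) - (i <= j)%N%:R)))
    (C *m bidiag R n.+1) P =
    block_mx T W C 0 *m block_mx (bidiag R n.+1) (- L) 0 1%:M.
  rewrite mulmx_block !mulmx0 !mulmx1 !addr0; congr block_mx.
    apply/matrixP => i j; rewrite mulmxN [RHS]mxE [X in X + _]mxE mulL !mxE ltnNge.
    by case: (i <= j)%N => /=; ring.
  apply/matrixP => i j; rewrite mulmxN [RHS]mxE mulL CP.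
  by field.
rewrite det_mulmx det_ublock det_bidiag det1 !mulr1.
(* [L0] is [W] without its first row; the shift of the row index turns [j < i] into [j <= i]. *)
pose L0 : 'M[R]_n := \matrix_(i, j) ((l j)^-1 * (j <= i)%N%:R).
have detL0 : \det L0 = \prod_i (l i)^-1.
  rewrite det_trig; first by apply: eq_bigr => i _; rewrite mxE leqnn mulr1.
  by apply/is_trig_mxP => i j ij; rewrite mxE leqNgt ij mulr0.
have L0u : L0 \in unitmx.
  by rewrite unitmxE detL0 unitfE; apply/prodf_neq0 => i _; rewrite invr_eq0.
(* [E'] is upper block triangular, and [W = E' *m Y] because the first row of
   [W] vanishes. *)
pose tau : 'rV[R]_n := \row_j T ord0 (lift ord0 j).
pose E' : 'M[R]_(1 + n) := block_mx 1%:M tau 0 L0.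
pose X : 'M[R]_(n, 1 + n) := invmx L0 *m (row_mx 0 L0 - @dsubmx _ 1 n (1 + n) T).
pose Y : 'M[R]_(1 + n, n) := col_mx (- tau) 1%:M.
have WE : W = col_mx (0 : 'M[R]_(1, n)) L0.
  apply/matrixP => i j; rewrite !mxE; case: splitP => k ik; rewrite !mxE.
    by rewrite ik ord1 mulr0.
  by rewrite ik.
rewrite (@det_block_drzero _ _ T E' W C X Y).
- rewrite /E' (@det_ublock _ 1 n) det1 mul1r detL0.
  have -> : C =
      row_mx (0 : 'M[R]_(n, 1)) (- (\matrix_(i, j) (l j * P i j)))
      :> 'M[R]_(n, 1 + n).
    apply/matrixP => i j; rewrite mxE; case: splitP => k jk.
      by rewrite mxE -(C0 i); congr (C _ _); apply: val_inj; rewrite /= jk ord1.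
    rewrite !mxE -CP; congr (C _ _); exact: val_inj.
  rewrite (@mul_row_col _ n 1 n) mul0mx add0r mulmx1 opprK.
  rewrite det_scale_cols mulrA -big_split /= big1 ?mul1r; last first.
    by move=> i _; rewrite mulVf.
  by congr (\det _); apply/matrixP => i j; rewrite mxE.
- rewrite WE (@mul_col_mx _ 1 n) mul0mx /X mulKVmx //.
  rewrite -{1}[T](@vsubmxK _ 1 n) (@add_col_mx _ 1 n) addr0 addrCA subrr addr0.
  rewrite /E' block_mxEv; apply: (congr2 (@col_mx R 1 n n.+1)) => //.
  apply/matrixP => i j.
  rewrite !mxE; case: splitP => k jk; rewrite !mxE !ord1.
    have -> : j = ord0 by apply: val_inj; rewrite /= jk ord1.
    by rewrite eqxx T1.
  by congr (T _ _); apply: val_inj.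
- by rewrite WE /E' /Y (@mul_block_col _ 1 n 1 n) !mulmx1 mul1mx mul0mx addNr add0r.
Qed.
End BlockDeterminant.

(** * The pure-birth semigroup on functions of exponential growth *)

Section Semigroup.
Variables (R : realType) (lam : nat -> R) (M : R).
Hypothesis lamM : forall x, `|lam x| <= M.

Local Notation L := (gen lam).

Definition exp_bounded (K B : R) (f : nat -> R) := forall x, `|f x| <= B * K ^+ x.

Definition exp_growth (K : R) (f : nat -> R) := exists B, exp_bounded K B f.

Let M_ge0 : 0 <= M.
Proof. exact: le_trans (lamM 0). Qed.

(** In the sup norm with weight [K ^+ x] the generator has norm at most [M * (K + 1)]: the shift to
    [x + 1] costs one factor [K]. *)
Lemma iter_gen_bounded K B f n : 0 <= K -> exp_bounded K B f ->
  exp_bounded K ((M * (K + 1)) ^+ n * B) (iter n L f).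
Proof.
move=> K0 fB; elim: n => [|n IHn] x; first by rewrite expr0 mul1r.
rewrite iterS /gen /nablaP normrM.
rewrite [leRHS](_ : _ = M * ((M * (K + 1)) ^+ n * B * K ^+ x.+1 +
  (M * (K + 1)) ^+ n * B * K ^+ x)); last by rewrite !exprS; ring.
by rewrite ler_pM// (le_trans (ler_normB _ _))// lerD.
Qed.

Definition expgen_term t f x n : R := t ^+ n / n`!%:R * iter n L f x.

Lemma expgen_term_bounded K B f t x n : 0 <= K -> exp_bounded K B f ->
  `|expgen_term t f x n| <= (B * K ^+ x) * exp_coeff (`|t| * (M * (K + 1))) n.
Proof.
move=> K0 fB; rewrite normrM normrM normrX normfV normr_nat.
rewrite [leRHS](_ : _ = `|t| ^+ n / n`!%:R * ((M * (K + 1)) ^+ n * B * K ^+ x)).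
  by rewrite ler_wpM2l ?iter_gen_bounded// divr_ge0 ?exprn_ge0.
by rewrite /exp_coeff /= (exprMn n `|t|); ring.
Qed.

Lemma is_cvg_normed_expgen K f t x : 0 <= K -> exp_growth K f ->
  cvgn [normed series (expgen_term t f x)].
Proof.
move=> K0 [B fB].
have := @is_cvg_series_exp_coeff R (`|t| * (M * (K + 1))).
move=> /(@is_cvg_seriesZ _ _ (B * K ^+ x)); apply: series_le_cvg => n //=.
  exact: le_trans (expgen_term_bounded t x n K0 fB).
exact: expgen_term_bounded.
Qed.

Lemma cvg_expgen K f t x : 0 <= K -> exp_growth K f ->
  series (expgen_term t f x) @ \oo --> expgen lam t f x.
Proof.
move=> K0 fK; rewrite /expgen.
have c : cvgn (series (expgen_term t f x)).
  exact: normed_cvg (is_cvg_normed_expgen K0 fK).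
exact: c.
Qed.

Lemma expgen_bounded K B f t : 0 <= K -> exp_bounded K B f ->
  exp_bounded K (expR (`|t| * (M * (K + 1))) * B) (expgen lam t f).
Proof.
move=> K0 fB x.
have cn := is_cvg_normed_expgen (t := t) (x := x) K0 (ex_intro _ B fB).
have ce := @is_cvg_series_exp_coeff R (`|t| * (M * (K + 1))).
apply: (le_trans (lim_series_norm cn)).
rewrite -mulrA mulrC /expR -[leRHS](lim_seriesZ (B * K ^+ x) ce).
apply: lim_series_le => //; first exact: is_cvg_seriesZ.
by move=> n; apply: expgen_term_bounded.
Qed.

Lemma iter_genD n (a b : R) f g :
  iter n L (fun z => a * f z + b * g z) =
  fun z => a * iter n L f z + b * iter n L g z.
Proof.
elim: n => // n IHn; rewrite iterS IHn; apply/funext => x.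
by rewrite !iterS /gen /nablaP; ring.
Qed.


Lemma exp_growthD K a b f g : exp_growth K f -> exp_growth K g ->
  exp_growth K (fun z => a * f z + b * g z).
Proof.
move=> [B fB] [C gC]; exists (`|a| * B + `|b| * C) => x.
rewrite (le_trans (ler_normD _ _))// mulrDl !normrM -!mulrA.
by rewrite lerD// ler_wpM2l.
Qed.

Lemma expgenD K (a b : R) f g t x : 0 <= K -> exp_growth K f -> exp_growth K g ->
  expgen lam t (fun z => a * f z + b * g z) x =
  a * expgen lam t f x + b * expgen lam t g x.
Proof.
move=> K0 fK gK; rewrite /expgen.
have cf : cvgn (series (expgen_term t f x)).
  exact: cvgP (cvg_expgen K0 fK).
have cg : cvgn (series (expgen_term t g x)).
  exact: cvgP (cvg_expgen K0 gK).
transitivity (a *: limn (series (expgen_term t f x)) +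
  b *: limn (series (expgen_term t g x))); last by [].
rewrite -(lim_seriesZ a cf) -(lim_seriesZ b cg) -lim_seriesD; last 2 first.
- exact: is_cvg_seriesZ.
- exact: is_cvg_seriesZ.
congr (limn (series _)); apply/funext => n.
rewrite iter_genD -[RHS]/(a * (_ * _) + b * (_ * _)); ring.
Qed.

Lemma exp_growth0 K : exp_growth K (fun=> 0).
Proof. by exists 0 => x; rewrite mul0r normr0. Qed.

Lemma expgen0 t x : expgen lam t (fun=> 0) x = 0.
Proof.
have := @expgenD 0 0 0 (fun=> 0) (fun=> 0) t x (lexx _)
  (exp_growth0 _) (exp_growth0 _).
by rewrite !mul0r !addr0.
Qed.

Lemma expgenZ K a f t x : 0 <= K -> exp_growth K f ->
  expgen lam t (fun z => a * f z) x = a * expgen lam t f x.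
Proof.
move=> K0 fK; have := expgenD a 0 t x K0 fK (exp_growth0 K).
rewrite !mul0r !addr0 => <-.
by congr expgen; apply/funext => z; rewrite addr0.
Qed.

Lemma exp_growth_sum K (I : Type) (r : seq I) (c : I -> R) (f : I -> nat -> R) :
  (forall i, exp_growth K (f i)) ->
  exp_growth K (fun z => \sum_(i <- r) c i * f i z).
Proof.
move=> fK; elim: r => [|i r IHr].
  by exists 0 => x; rewrite big_nil normr0 mul0r.
have [B HB] := exp_growthD (c i) 1 (fK i) IHr; exists B => x.
by have := HB x; rewrite big_cons mul1r.
Qed.

Lemma expgen_sum K (I : Type) (r : seq I) (c : I -> R) (f : I -> nat -> R) t x :
  0 <= K -> (forall i, exp_growth K (f i)) ->
  expgen lam t (fun z => \sum_(i <- r) c i * f i z) x =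
  \sum_(i <- r) c i * expgen lam t (f i) x.
Proof.
move=> K0 fK; elim: r => [|i r IHr].
  rewrite big_nil -[RHS](expgen0 t x).
  by congr expgen; apply/funext => z; rewrite big_nil.
rewrite big_cons -IHr -[X in _ + X]mul1r.
rewrite -(expgenD (c i) 1 t x K0 (fK i) (exp_growth_sum r c fK)).
by congr expgen; apply/funext => z; rewrite big_cons mul1r.
Qed.

(** The generator reads only the values at [x] and [x + 1], so it passes through the convergent
    series term by term, and it commutes with its own powers. *)
Lemma gen_expgen K f t x : 0 <= K -> exp_growth K f ->
  L (expgen lam t f) x = expgen lam t (L f) x.
Proof.
move=> K0 fK; rewrite /gen /nablaP /expgen.
have c1 : cvgn (series (expgen_term t f x.+1)).
  exact: cvgP (cvg_expgen K0 fK).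
have c0 : cvgn (series (expgen_term t f x)).
  exact: cvgP (cvg_expgen K0 fK).
transitivity (lam x *: (limn (series (expgen_term t f x.+1)) -
  limn (series (expgen_term t f x)))); first by [].
rewrite -(lim_seriesB c1 c0) -(lim_seriesZ (lam x)); last exact: is_cvg_seriesB.
congr (limn (series _)); apply/funext => n.
rewrite -iterSr iterS /gen /nablaP -[LHS]/(lam x * (_ * _ - _ * _)).
by ring.
Qed.

Lemma exp_bounded_indic K y : 0 < K ->
  exp_bounded K (K ^- y) (fun z => (z == y)%:R).
Proof.
move=> K0 x; case: (eqVneq x y) => [->|_] /=.
  by rewrite normr1 mulVf// expf_neq0// gt_eqF.
by rewrite normr0 mulr_ge0 ?invr_ge0 ?exprn_ge0 ?ltW.
Qed.

(** The indicator of [y] has norm [K ^- y] in the weight [K ^+ x]. Since [K] is free, the decay in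
    [y] beats any exponential; below, [K = 8] gives summability and [K = 1] a uniform bound. *)
Lemma trans_bounded K t x y : 0 < K ->
  `|trans lam t x y| <= expR (`|t| * (M * (K + 1))) * K ^+ x * K ^- y.
Proof.
move=> K0; rewrite mulrAC.
exact: expgen_bounded (ltW K0) (exp_bounded_indic y K0) x.
Qed.

Lemma sum_trans m (f : nat -> R) t x :
  \sum_(y < m) trans lam t x y * f y =
  expgen lam t (fun z => f z * (z < m)%N%:R) x.
Proof.
transitivity (expgen lam t (fun z => \sum_(y < m) f y * (z == y)%:R) x).
  rewrite (@expgen_sum 1)//; first by apply: eq_bigr => y _; rewrite mulrC.
  by move=> i; exists (1 ^- i); apply: exp_bounded_indic.
congr expgen; apply/funext => z.
have [zm|mz] := ltnP z m.
  rewrite (bigD1 (Ordinal zm)) //= eqxx big1 ?addr0// => i.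
  by rewrite -val_eqE /= eq_sym => /negbTE ->; rewrite mulr0.
rewrite mulr0 big1 // => i _.
by rewrite gtn_eqF ?mulr0// (leq_trans (ltn_ord i)).
Qed.

(** The part of [f] beyond [m], measured against the larger weight [(2 * K) ^+ z], has norm at most
    [B * 2^-1 ^+ m], and the semigroup is bounded for that weight. *)
Lemma cvg_sum_trans K f t x : 1 <= K -> exp_growth K f ->
  (\sum_(y < m) trans lam t x y * f y) @[m --> \oo] --> expgen lam t f x.
Proof.
move=> K1 [B fB].
have K0 : 0 <= K by apply: le_trans K1.
have B0 : 0 <= B by have := fB 0; rewrite expr0 mulr1; apply: le_trans.
have tailB m : exp_bounded (2 * K) (B * 2^-1 ^+ m) (fun z => f z * (m <= z)%N%:R).
  move=> z; rewrite normrM normr_nat exprMn.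
  have [mz|_] := leqP m z; last by rewrite mulr0 !mulr_ge0 ?exprn_ge0.
  rewrite mulr1 (le_trans (fB z)) // //.
  rewrite [leRHS](_ : _ = (B * K ^+ z) * (2^-1 ^+ m * 2 ^+ z)); last by ring.
  rewrite ler_peMr ?mulr_ge0 ?exprn_ge0 //.
  rewrite exprVn mulrC ler_pdivlMr ?exprn_gt0 // mul1r.
  by rewrite ler_weXn2l // ler1n.
have K20 : 0 <= 2 * K by rewrite mulr_ge0.
pose c := expR (`|t| * (M * (2 * K + 1))) * B * (2 * K) ^+ x.
have splitE m : expgen lam t f x - \sum_(y < m) trans lam t x y * f y =
    expgen lam t (fun z => f z * (m <= z)%N%:R) x.
  have fK2 : exp_bounded (2 * K) B f.
    move=> z; rewrite (le_trans (fB z))// ler_wpM2l // lerXn2r ?nnegrE //.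
    by rewrite ler_peMl // ler1n.
  have fm : exp_bounded (2 * K) B (fun z => f z * (z < m)%N%:R).
    move=> z; rewrite normrM normr_nat (le_trans _ (fK2 z)) //.
    by rewrite ler_piMr // lern1 leq_b1.
  rewrite sum_trans -[X in X - _]mul1r -mulN1r.
  rewrite -(expgenD 1 (-1) t x K20 (ex_intro _ B fK2) (ex_intro _ B fm)).
  by congr expgen; apply/funext => z; case: ltnP => _ /=; ring.
apply/subr_cvg0/norm_cvg0P.
have : (c * 2^-1 ^+ m) @[m --> \oo] --> (c * 0 : R).
  apply: cvgMl_tmp; apply: cvg_expr.
  by rewrite ger0_norm ?invr_ge0 // invf_lt1 // ltr1n.
rewrite mulr0; apply: squeeze_cvgr; last exact: cvg_cst.
apply: nearW => m; rewrite normr_ge0 /= -normrN opprB splitE.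
rewrite (le_trans (expgen_bounded t K20 (tailB m) x)) //.
rewrite le_eqVlt; apply/orP; left; apply/eqP; rewrite /c; ring.
Qed.

Lemma cumulE t x b : cumul lam t x b%:Z = expgen lam t (fun z => (z <= b)%N%:R) x.
Proof.
rewrite /cumul big_mkord; transitivity (\sum_(y < b.+1) trans lam t x y * 1).
  by apply: eq_bigr => y _; rewrite mulr1.
rewrite (sum_trans b.+1 (fun=> 1)).
by congr expgen; apply/funext => z; rewrite mul1r.
Qed.

Lemma exp_growth_le b : exp_bounded 1 1 (fun z => (z <= b)%N%:R).
Proof. by move=> x; rewrite expr1n mulr1 normr_nat lern1 leq_b1. Qed.

Lemma cumul_bounded t x b : `|cumul lam t x b%:Z| <= expR (`|t| * (M * 2)).
Proof.
rewrite cumulE; have := expgen_bounded t ler01 (exp_growth_le b) x.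
by rewrite expr1n !mulr1.
Qed.

(* Kolmogorov's forward equation, since [gen] commutes with the semigroup. *)
Lemma gen_cumul t x b :
  L (fun u => cumul lam t u b%:Z) x = - (lam b * trans lam t x b).
Proof.
have -> : (fun u => cumul lam t u b%:Z) = expgen lam t (fun z => (z <= b)%N%:R).
  by apply/funext => u; rewrite cumulE.
have g1 : exp_growth 1 (fun z => (z <= b)%N%:R) by exists 1; apply: exp_growth_le.
rewrite (gen_expgen t x ler01 g1) -mulNr -(@expgenZ 1)//; last first.
  by exists (1 ^- b); apply: exp_bounded_indic.
congr expgen; apply/funext => z; rewrite /gen /nablaP.
have [zb|bz|->] := ltngtP z b; rewrite ?mulr0.
- by rewrite subrr mulr0.
- by rewrite subrr mulr0.
- by rewrite sub0r mulrN mulNr.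
Qed.

End Semigroup.

(** * The harmonic function as a determinant *)

Lemma sum_ord_interval (V : zmodType) m a b (f : nat -> V) :
  (a <= b)%N -> (b <= m)%N ->
  \sum_(k < m | (a <= k)%N && (k < b)%N) f k = \sum_(k < b) f k - \sum_(k < a) f k.
Proof.
move=> ab bm; rewrite -(big_mkord xpredT f) -[X in _ - X](big_mkord xpredT f).
rewrite (big_cat_nat (n := a)) //= addrAC subrr add0r.
rewrite (big_nat_widen _ _ _ _ _ bm) (big_nat_widenl _ _ _ _ _ (leq0n a)) big_mkord.
by apply: eq_bigl => k; rewrite andbC.
Qed.

Lemma in_weylP n (x : config n) :
  reflect (forall i j : 'I_n, (i < j)%N -> (x i < x j)%N) (in_weyl x).
Proof.
apply: (iffP forallP) => [H i j ij|H i]; last by apply/forallP => j; apply/implyP/H.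
by have /forallP/(_ j)/implyP/(_ ij) := H i.
Qed.

Lemma interlaceP n (y : config n) (x : config n.+1) :
  reflect (forall i : 'I_n,
    (x (widen_ord (leqnSn n) i) <= y i)%N /\ (y i < x (lift ord0 i))%N)
    (interlace y x).
Proof. by apply: (iffP forallP) => H i; apply/andP. Qed.

(** Consecutive entries satisfy y_i < x_(i+1) <= y_(i+1); the rest is induction on [j - i]. *)
Lemma interlace_weyl n (y : config n) (x : config n.+1) :
  interlace y x -> in_weyl y.
Proof.
move=> /interlaceP yx.
apply/in_weylP => i j.
have [m] := ubnP (j - i)%N; elim: m i => // m IHm i jim ij.
have iSj : (i.+1 <= j)%N by [].
have iSn : (i.+1 < n)%N by apply: leq_ltn_trans ij (ltn_ord j).
pose i' := Ordinal iSn.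
have yi : (y i < y i')%N.
  have [_ h1] := yx i; have [h2 _] := yx i'.
  apply: (leq_trans h1); apply: leq_trans h2.
  by have -> : lift ord0 i = widen_ord (leqnSn n) i' by apply: val_inj.
have [<-//|ne] := eqVneq i' j.
apply: (ltn_trans yi); apply: IHm.
  rewrite /= subnS; lia.
by rewrite ltn_neqAle -val_eqE /= in ne *; rewrite ne.
Qed.

(** Configurations with entries below [m] are coded by a finite type, so that sums over a box are
    ordinary finite sums. *)
Definition config_of n m (g : {ffun 'I_n -> 'I_m}) : config n :=
  [ffun i => g i : nat].

Lemma config_of_inj n m : injective (@config_of n m).
Proof.
move=> g h E; apply/ffunP => i; apply: val_inj.
by have := congr1 (fun k : config n => k i) E; rewrite !ffunE.
Qed.

Lemma config_ofP n m (y : config n) : (forall i, (y i < m)%N) ->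
  exists g : {ffun 'I_n -> 'I_m}, config_of g = y.
Proof.
move=> ym; exists [ffun i => Ordinal (ym i)].
by apply/ffunP => i; rewrite !ffunE.
Qed.

Definition slot n (x : config n.+1) (i : 'I_n) : pred nat :=
  fun k => (x (widen_ord (leqnSn n) i) <= k)%N && (k < x (lift ord0 i))%N.

(** For given [x] the constraint bears on each coordinate of [y] separately; this product form is
    what multilinearity requires. *)
Lemma interlace_config_of n m (g : {ffun 'I_n -> 'I_m}) (x : config n.+1) :
  interlace (config_of g) x = (g \in family (fun i (k : 'I_m) => slot x i k)).
Proof.
by apply/forallP/familyP => H i; have := H i; rewrite ffunE.
Qed.

Lemma fsum_interlace (R : realType) n m (x : config n.+1) (F : config n -> R) :
  in_weyl x -> (forall i, x i <= m)%N ->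
  \sum_(y \in [set y : config n | in_weyl y /\ interlace y x]) F y =
  \sum_(g : {ffun 'I_n -> 'I_m} | g \in family (fun i (k : 'I_m) => slot x i k))
     F (config_of g).
Proof.
move=> xw xm.
rewrite (fsbigE [seq config_of g | g : {ffun 'I_n -> 'I_m} in
   [pred g | interlace (config_of g) x]]).
- rewrite big_map big_enum_cond /=; apply: eq_bigl => g.
  rewrite inE -interlace_config_of; case E: interlace => //=.
  by apply: mem_set; split => //; apply: interlace_weyl E.
- rewrite map_inj_uniq ?enum_uniq //; exact: config_of_inj.
- move=> y /= /mapP[g]; rewrite mem_enum inE => gx ->.
  by split => //; apply: interlace_weyl gx.
- move=> y [yw yx]; have ym i : (y i < m)%N.
    by have /interlaceP/(_ i)[_ h] := yx; apply: leq_trans (xm (lift ord0 i)).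
  have [g gy] := config_ofP ym.
  by case/negP; apply/mapP; exists g; rewrite ?mem_enum ?inE gy.
Qed.

Lemma det_bounded_cols (R : numDomainType) n (b : 'I_n -> R) (A : 'M[R]_n) :
  (forall i j, `|A i j| <= b j) -> `|\det A| <= n`!%:R * \prod_j b j.
Proof.
move=> Ab; rewrite (le_trans (ler_norm_sum _ _ _)) //.
rewrite -card_Sn -sum1_card natr_sum mulr_suml ler_sum // => s _.
rewrite normrM normrX normrN1 expr1n !mul1r normr_prod.
rewrite [leRHS](reindex_inj (@perm_inj _ s)) ler_prod // => i _.
by rewrite normr_ge0 Ab.
Qed.

Section Harmonic.
Variables (R : realType) (lam : nat -> R).

Fixpoint phi (j : nat) (x : nat) : R :=
  if j is j'.+1 then \sum_(z < x) (lam z)^-1 * phi j' z else 1.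

Lemma gen_phi0 : gen lam (phi 0) = fun=> 0.
Proof. by apply/funext => x; rewrite /gen /nablaP subrr mulr0. Qed.

Lemma hfunS n (x : config n.+2) : hfun lam x =
   \sum_(y \in [set y : config n.+1 | in_weyl y /\ interlace y x])
        (\prod_(i < n.+1) (lam (y i))^-1 * hfun lam y).
Proof. by []. Qed.

(** By multilinearity the recursion sums row [i] over its slot, which gives the difference of
    phi_(j+1) between consecutive entries of [x]. These are the first differences of the larger
    determinant, whose first column is phi_0 = 1. *)
Lemma hfun_det n (x : config n.+1) : in_weyl x ->
  hfun lam x = \det (\matrix_(i, j) phi j (x i)).
Proof.
elim: n x => [|n IHn] x xw; first by rewrite /= det_mx11 mxE.
rewrite hfunS (@fsum_interlace _ _ (\max_i x i)) //; last first.
  by move=> i; apply: leq_bigmax.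
set m := \max_i x i.
pose a (i : 'I_n.+1) (k : 'I_m) (j : 'I_n.+1) := (lam k)^-1 * phi j k.
transitivity (\sum_(g in family (fun i (k : 'I_m) => slot x i k))
   \det (\matrix_(i, j) a i (g i) j)).
  apply: eq_bigr => g; rewrite -interlace_config_of => gx.
  rewrite IHn; last exact: interlace_weyl gx.
  under eq_bigr do rewrite ffunE.
  rewrite (det_scale_rows (fun i => (lam (g i))^-1) (fun i j => phi j (g i))).
  by congr (_ * \det _); apply/matrixP => i j; rewrite !mxE ffunE.
rewrite det_mx_sum [RHS]det_first_differences; last by move=> i; rewrite mxE.
congr (\det _); apply/matrixP => i j; rewrite !mxE.
rewrite /slot (sum_ord_interval (fun k => (lam k)^-1 * phi j k)) //.
  by apply: ltnW; move/in_weylP: xw; apply.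
exact: leq_bigmax.
Qed.

Hypothesis lam_gt0 : forall x, 0 < lam x.

Let lam_neq0 x : lam x != 0.
Proof. by rewrite gt_eqF. Qed.

Lemma hfun_gt0 n (x : config n.+1) : in_weyl x -> 0 < hfun lam x.
Proof.
elim: n x => [|n IHn] x xw; first by rewrite /= ltr01.
rewrite hfunS (@fsum_interlace _ _ (\max_i x i)) //; last first.
  by move=> i; apply: leq_bigmax.
set m := \max_i x i.
(* Deleting the last entry of [x] gives an interlacing configuration, so the sum of positive terms
   is not empty. *)
pose y : config n.+1 := [ffun i => x (widen_ord (leqnSn n.+1) i)].
have yx : interlace y x.
  apply/interlaceP => i; rewrite ffunE; split => //.
  by move/in_weylP: xw; apply.
have ym i : (y i < m)%N.
  have /interlaceP/(_ i)[_ h] := yx; apply: leq_trans h _; exact: leq_bigmax.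
have [g gy] := config_ofP ym.
have term h : interlace (@config_of n.+1 m h) x ->
    0 < \prod_(i < n.+1) (lam (config_of h i))^-1 * hfun lam (config_of h).
  move=> hx; rewrite mulr_gt0 ?prodr_gt0 //; last exact/IHn/interlace_weyl/hx.
  by move=> i _; rewrite invr_gt0.
rewrite (bigD1 g) /=; last by rewrite -interlace_config_of gy.
rewrite ltr_pwDl ?term ?gy // sumr_ge0 // => h /andP[hx _].
by rewrite ltW // term // interlace_config_of.
Qed.

Lemma gen_phiS j : gen lam (phi j.+1) = phi j.
Proof.
apply/funext => x; rewrite /gen /nablaP /= big_ord_recr /= addrAC subrr add0r.
by rewrite mulVKf.
Qed.

Lemma phi_ge0 j x : 0 <= phi j x.
Proof.
elim: j x => // j IHj x /=; apply: sumr_ge0 => z _.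
by rewrite mulr_ge0 // invr_ge0 ltW.
Qed.

Lemma iter_gen_phi j n :
  iter n (gen lam) (phi j) = if (n <= j)%N then phi (j - n) else fun=> 0.
Proof.
elim: n => [|n IHn]; first by rewrite subn0.
rewrite iterS IHn; have [nj|jn|->] := ltngtP n j.
- by rewrite -(subnSK nj) gen_phiS.
- by apply/funext => x; rewrite /gen /nablaP subrr mulr0.
- by rewrite subnn gen_phi0.
Qed.

Lemma expgen_phi j t x :
  expgen lam t (phi j) x = \sum_(k < j.+1) t ^+ k / k`!%:R * phi (j - k) x.
Proof.
apply: cvg_lim => //; apply: (@cvg_near_cst _ R^o).
(* The generator is nilpotent on [phi lam j]: all terms beyond the index [j] vanish and the partial
   sums become constant. *)
near=> n; rewrite /series /= (big_cat_nat (n := j.+1)) //=; last first.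
  by near: n; exists j.+1.
rewrite big_mkord [X in _ + X]big_nat_cond [X in _ + X]big1 ?addr0.
  by apply: eq_bigr => k _; rewrite iter_gen_phi -ltnS ltn_ord.
by move=> k /andP[/andP[jk _] _]; rewrite iter_gen_phi leqNgt jk mulr0.
Unshelve. all: by end_near. Qed.

Lemma det_expgen_phi n t (x : 'I_n -> nat) :
  \det (\matrix_(i < n, j < n) expgen lam t (phi j) (x i)) =
  \det (\matrix_(i < n, j < n) phi j (x i)).
Proof.
pose U : 'M[R]_n := \matrix_(l, j) ((l <= j)%N%:R * (t ^+ (j - l) / (j - l)`!%:R)).
have detU : \det U = 1.
  rewrite -det_tr det_trig.
    by rewrite big1 // => i _; rewrite !mxE leqnn subnn expr0 fact0 divr1 mulr1.
  by apply/is_trig_mxP => i j ij; rewrite !mxE leqNgt ij mul0r.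
rewrite -[RHS]mulr1 -detU -det_mulmx; congr (\det _).
apply/matrixP => i j; rewrite !mxE expgen_phi.
(* Replacing [k] by [j - k] exhibits the sum as an entry of the product with [U]. *)
rewrite (reindex_inj rev_ord_inj) /=.
pose F k := phi k (x i) * (t ^+ (j - k) / (j - k)`!%:R).
transitivity (\sum_(k < j.+1) F k).
  apply: eq_bigr => k _; have kj : (k <= j)%N by rewrite -ltnS ltn_ord.
  by rewrite /F subSS (subKn kj) mulrC.
rewrite (big_ord_widen n F (ltn_ord j)) big_mkcond; apply: eq_bigr => k _.
by rewrite !mxE ltnS; case: leqP => _; rewrite ?mul1r ?mul0r ?mulr0.
Qed.

Variable c : R.
Hypotheses (c_gt0 : 0 < c) (lamc : forall x, c <= lam x).

(** Each summation costs a factor [c^-1], and the base 2 survives because the sum of [2 ^+ z] over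
    [z < x] is at most [2 ^+ x]. *)
Lemma phi_bounded j : exp_bounded 2 (c ^- j) (phi j).
Proof.
elim: j => [|j IHj] x; rewrite ger0_norm ?phi_ge0 //.
  by rewrite invr1 mul1r exprn_ege1 // ler1n.
have step z : (lam z)^-1 * phi j z <= c ^- j.+1 * 2 ^+ z.
  rewrite exprS invfM -mulrA; apply: ler_pM; rewrite ?phi_ge0 //.
  - by rewrite invr_ge0 ltW.
  - by rewrite lef_pV2 ?posrE.
  - by have := IHj z; rewrite ger0_norm ?phi_ge0.
elim: x => [|x IHx].
  by rewrite /= big_ord0 mulr_ge0 ?invr_ge0 ?exprn_ge0 // ltW.
rewrite [phi _ _]/= big_ord_recr /= (exprS 2) mulrCA mulr_natl mulr2n.
by rewrite lerD // IHx.
Qed.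

Lemma hfun_bounded n : exists2 B, 0 <= B & forall x : config n.+1, in_weyl x ->
  `|hfun lam x| <= B * \prod_i 2 ^+ x i.
Proof.
pose K := \sum_(j < n.+1) c ^- j.
have cj j : 0 <= c ^- j by rewrite invr_ge0 exprn_ge0 // ltW.
have K0 : 0 <= K by apply: sumr_ge0.
exists ((n.+1)`!%:R * \prod_(i < n.+1) K); first by rewrite mulr_ge0 // prodr_ge0.
(* After transposition the columns are indexed by the entries of [x]; [K] dominates every [c ^- j],
   so the bound of a column does not depend on [j]. *)
move=> x xw; rewrite hfun_det // -det_tr -mulrA -big_split /=.
apply: det_bounded_cols => j i; rewrite !mxE (le_trans (phi_bounded j (x i))) //.
by rewrite ler_wpM2r ?exprn_ge0 // /K (bigD1 j) //= lerDl sumr_ge0.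
Qed.
End Harmonic.

(** * Unordered sums *)

Section UnorderedSums.
Variable R : realType.

Lemma sum_fsubset (I : choiceType) (A A' : {fset I}) (F : I -> R) :
  (A `<=` A')%fset ->
  \sum_(i <- A') F i = \sum_(i <- A) F i + \sum_(i <- (A' `\` A)%fset) F i.
Proof.
move=> AA'; rewrite -big_cat /=; apply: perm_big; apply: uniq_perm.
- exact: fset_uniq.
- rewrite cat_uniq !fset_uniq andbT /=; apply/hasPn => x.
  by rewrite in_fsetD => /andP[].
- move=> x; rewrite mem_cat in_fsetD; have [xA|//] := boolP (x \in A).
  by rewrite (fsubsetP AA' x xA).
Qed.

(** Outside a finite set that nearly attains the supremum of the absolute sums, any further terms
    add little; hence one good approximation containing that set controls all larger sets. *)
Lemma has_sum_of_dominated (I : choiceType) (v : I -> R) (s C : R) :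
  (forall A : {fset I}, \sum_(i <- A) `|v i| <= C) ->
  (forall (B : {fset I}) e, 0 < e -> exists A : {fset I},
     (B `<=` A)%fset /\ `|\sum_(i <- A) v i - s| < e) ->
  has_sum v s.
Proof.
move=> vC approx.
pose E : set R := range (fun A : {fset I} => \sum_(i <- A) `|v i|).
have hsE : has_sup E.
  split; first by exists (\sum_(i <- fset0) `|v i|), fset0.
  by exists C => _ [A _ <-].
rewrite /has_sum; apply/(cvgrPdist_lt (FF := summability.totally_filter)) => e e0.
have e20 : 0 < e / 2 by rewrite divr_gt0.
have [_ [B _ <-] Bsup] := sup_adherent e20 hsE.
have [A [BA As]] := approx B (e / 2) e20.
exists A => // A' /= AA'.
have -> : s - \sum_(i <- A') v i =
    - (\sum_(i <- A) v i - s) - \sum_(i <- (A' `\` A)%fset) v i.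
  by rewrite (sum_fsubset v AA'); ring.
rewrite (le_lt_trans (ler_normB _ _)) // normrN (splitr e) ltrD //.
rewrite (le_lt_trans (ler_norm_sum _ _ _)) //.
have := sum_fsubset (fun i => `|v i|) AA'.
have := sum_fsubset (fun i => `|v i|) BA.
have : \sum_(i <- A') `|v i| <= sup E.
  by apply: sup_ubound => //; [case: hsE|exists A'].
have : 0 <= \sum_(i <- (A `\` B)%fset) `|v i| by apply: sumr_ge0.
move: Bsup; lra.
Qed.

(** The finite types [J k] exhaust [T]. The index [k] may be chosen anew for each finite set and
    tolerance, so an iterated limit with two cutoffs is enough. *)
Lemma has_sum_sig (T : choiceType) (P : pred T) (u : T -> R) (s C : R)
    (K : Type) (J : K -> finType) (e : forall k, J k -> T) :
  (forall k, injective (e k)) ->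
  (forall k, \sum_(j : J k | P (e k j)) `|u (e k j)| <= C) ->
  (forall (B : {fset T}) eps, 0 < eps -> exists k,
     (forall x, x \in B -> exists j, e k j = x) /\
     `|\sum_(j : J k | P (e k j)) u (e k j) - s| < eps) ->
  has_sum (fun z : {x : T | P x} => u (val z)) s.
Proof.
move=> eI uC approx.
pose q k : seq {x : T | P x} := pmap insub [seq e k j | j : J k].
pose D k : {fset {x : T | P x}} := seq_fset tt (q k).
have sumD k (F : T -> R) :
    \sum_(z <- D k) F (val z) = \sum_(j : J k | P (e k j)) F (e k j).
  have -> : \sum_(z <- D k) F (val z) = \sum_(z <- q k) F (val z).
    apply: perm_big; apply: uniq_perm; first exact: fset_uniq.
      by rewrite pmap_sub_uniq // (map_inj_uniq (eI k)) enum_uniq.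
    by move=> z; rewrite seq_fsetE.
  transitivity (\sum_(j <- enum (J k) | P (e k j)) F (e k j)); last first.
    by rewrite big_enum_cond.
  rewrite /q /image_mem; elim: (enum _) => [|j l IHl] /=.
    by rewrite !big_nil.
  rewrite big_cons; case: ifPn => Pj.
    by rewrite insubT /= big_cons IHl.
  by rewrite insubN.
have subD k (A : {fset {x : T | P x}}) :
    (forall x, x \in [fset val z | z in A]%fset -> exists j, e k j = x) ->
    (A `<=` D k)%fset.
  move=> cov; apply/fsubsetP => z zA.
  rewrite seq_fsetE mem_pmap_sub /=.
  have [j <-] := cov (val z) (in_imfset _ _ zA).
  by rewrite map_f ?mem_enum.
apply: (@has_sum_of_dominated _ _ _ C) => [A|A eps eps0].
  have [k [cov _]] := approx [fset val z | z in A]%fset 1 ltr01.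
  rewrite (le_trans _ (uC k)) // -(sumD k (fun x => `|u x|)).
  by rewrite (sum_fsubset _ (subD k A cov)) lerDl sumr_ge0.
have [k [cov us]] := approx [fset val z | z in A]%fset eps eps0.
by exists (D k); split; [exact: subD|rewrite sumD].
Qed.

Lemma sum_half_powers m : \sum_(k < m) (2^-1 : R) ^+ k <= 2.
Proof.
suff -> : \sum_(k < m) (2^-1 : R) ^+ k = 2 - 2 * 2^-1 ^+ m.
  by rewrite lerBlDr lerDl mulr_ge0 // exprn_ge0 // invr_ge0.
elim: m => [|m IHm]; first by rewrite big_ord0 expr0; ring.
by rewrite big_ord_recr /= IHm exprS; field.
Qed.

Lemma sum_half_powers_box n m :
  \sum_(g : {ffun 'I_n -> 'I_m}) \prod_i (2^-1 : R) ^+ g i <= 2 ^+ n.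
Proof.
rewrite -(bigA_distr_bigA (fun (i : 'I_n) (k : 'I_m) => (2^-1 : R) ^+ k)).
rewrite prodr_const card_ord lerXn2r ?nnegrE ?sum_half_powers //.
by rewrite sumr_ge0 // => k _; rewrite exprn_ge0 // invr_ge0.
Qed.

Lemma cvg_det n (F : set_system nat) (A : nat -> 'M[R]_n) (B : 'M[R]_n) :
  Filter F ->
  (forall i j, A m i j @[m --> F] --> B i j) -> \det (A m) @[m --> F] --> \det B.
Proof.
move=> FF AB; apply: (cvg_big add_continuous) => s _.
apply: cvgMl_tmp; apply: (cvg_big mul_continuous) => i _; exact: AB.
Qed.

End UnorderedSums.

(** * The two semigroups *)

Lemma config_fset_bounded n (B : {fset config n}) :
  exists m0, forall x, x \in B -> forall i, (x i < m0)%N.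
Proof.
exists (\max_(x <- B) \max_i x i).+1 => x xB i; rewrite ltnS.
apply: (@leq_trans (\max_i x i)); first exact: leq_bigmax.
by apply: (@leq_bigmax_seq _ _ xpredT (fun x : config n => \max_i x i)%N).
Qed.

Lemma in_weyl_config_of n m (g : {ffun 'I_n -> 'I_m}) :
  in_weyl (config_of g) = increasing_ffun g.
Proof.
by apply/in_weylP/increasing_ffunP => H i j /H; rewrite !ffunE.
Qed.

Section Slots.
Variables (n m : nat) (y : config n).

(* For fixed [y], the interlacing constraint on an [x] with entries below [m] is
   [slot_start j <= x j < slot_end j] for each [j] separately. *)
Definition slot_start (j : 'I_n.+1) : nat :=
  if unlift ord0 j is Some i then (y i).+1 else 0.

Definition slot_end (j : 'I_n.+1) : nat :=
  if unlift ord_max j is Some i then (y i).+1 else m.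

Lemma lift_max_widen (i : 'I_n) : lift ord_max i = widen_ord (leqnSn n) i.
Proof. by apply: val_inj; exact: lift_max. Qed.

Lemma slot_start_lift i : slot_start (lift ord0 i) = (y i).+1.
Proof. by rewrite /slot_start liftK. Qed.

Lemma slot_start0 : slot_start ord0 = 0.
Proof. by rewrite /slot_start unlift_none. Qed.

Lemma slot_end_widen i : slot_end (widen_ord (leqnSn n) i) = (y i).+1.
Proof. by rewrite -lift_max_widen /slot_end liftK. Qed.

Lemma slot_end_max : slot_end ord_max = m.
Proof. by rewrite /slot_end unlift_none. Qed.

Lemma ordS_casesr (P : 'I_n.+1 -> Prop) :
  (forall i, P (widen_ord (leqnSn n) i)) -> P ord_max -> forall j, P j.
Proof.
by move=> Pw Pm j; case: (unliftP ord_max j) => [i|] ->; rewrite ?lift_max_widen.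
Qed.

Lemma ordS_casesl (P : 'I_n.+1 -> Prop) :
  P ord0 -> (forall i, P (lift ord0 i)) -> forall j, P j.
Proof. by move=> P0 Pl j; case: (unliftP ord0 j) => [i|] ->. Qed.

Lemma slot_end_le j : (forall i, y i < m)%N -> (slot_end j <= m)%N.
Proof.
by move=> ym; elim/ordS_casesr: j => [i|]; rewrite ?slot_end_widen ?slot_end_max.
Qed.

Lemma slot_start_end j : (forall i, y i < m)%N -> in_weyl y ->
  (slot_start j <= slot_end j)%N.
Proof.
move=> ym /in_weylP yw; elim/ordS_casesl: j => [|i]; first by rewrite slot_start0.
rewrite slot_start_lift; case: (unliftP ord_max (lift ord0 i)) => [k|] E.
  rewrite E lift_max_widen slot_end_widen ltnS ltnW // yw //.
  by have := congr1 (@nat_of_ord _) E; rewrite lift_max lift0 => <-.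
by rewrite E slot_end_max.
Qed.

Lemma interlace_slots (g : {ffun 'I_n.+1 -> 'I_m}) :
  interlace y (config_of g) =
  (g \in family (fun j (k : 'I_m) => (slot_start j <= k)%N && (k < slot_end j)%N)).
Proof.
apply/interlaceP/familyP => [H j|H i].
  apply/andP; split.
    elim/ordS_casesl: j => [|i]; first by rewrite slot_start0.
    by rewrite slot_start_lift; have [_] := H i; rewrite ffunE.
  elim/ordS_casesr: j => [i|]; last by rewrite slot_end_max.
  by rewrite slot_end_widen ltnS; have [+ _] := H i; rewrite ffunE.
split.
  by have /andP[_] := H (widen_ord (leqnSn n) i); rewrite slot_end_widen ltnS ffunE.
by have /andP[+ _] := H (lift ord0 i); rewrite slot_start_lift ffunE.
Qed.
End Slots.

Section Kernels.
Variables (R : realType) (lam : nat -> R) (c M : R).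
Hypothesis lam_gt0 : forall x, 0 < lam x.
Hypotheses (c_gt0 : 0 < c) (lamc : forall x, c <= lam x).
Hypothesis lamM : forall x, lam x <= M.

Let lam_abs x : `|lam x| <= M.
Proof. by rewrite gtr0_norm. Qed.

Lemma phi_growth j : exp_growth 2 (phi lam j).
Proof. exists (c ^- j); exact: (phi_bounded lam_gt0 c_gt0 lamc). Qed.

(** With [8 = 2 * 4], the spare factor [4 ^- b] pays for [4 ^+ a]. This trades the decay of the
    kernels against the growth of [hfun]. *)
Lemma half_power_le a b : (a <= b)%N ->
  8 ^- b * 2 ^+ a <= (2^-1 : R) ^+ b * 2^-1 ^+ a.
Proof.
move=> ab; have -> : (8 : R) ^- b = 2^-1 ^+ b * 4 ^- b.
  by rewrite exprVn -invfM -exprMn; congr (_ ^- _); ring.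
rewrite -mulrA ler_wpM2l ?exprn_ge0 ?invr_ge0 // mulrC ler_pdivrMr ?exprn_gt0 //.
have -> : (2 : R) ^+ a = 2^-1 ^+ a * 4 ^+ a.
  by rewrite -exprMn; congr (_ ^+ _); field.
by rewrite ler_wpM2l ?exprn_ge0 ?invr_ge0 // ler_weXn2l // ler1n.
Qed.

Lemma sum_KM_box n m t (x : config n.+1) :
  \sum_(g : {ffun 'I_n.+1 -> 'I_m} | in_weyl (config_of g))
     \det (\matrix_(i, j) trans lam t (x i) (config_of g j)) *
     hfun lam (config_of g) =
  \det (\matrix_(i, j) \sum_(k < m) trans lam t (x i) k * phi lam j k).
Proof.
rewrite (cauchy_binet (fun i (k : 'I_m) => trans lam t (x i) k)
  (fun k j => phi lam j k)).
apply: eq_big => g; first by rewrite in_weyl_config_of.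
move=> gw; rewrite hfun_det //; congr (_ * _); congr (\det _);
  by apply/matrixP => i j; rewrite !mxE ffunE.
Qed.

Lemma cvg_sum_KM_box n t (x : config n.+1) : in_weyl x ->
  (\sum_(g : {ffun 'I_n.+1 -> 'I_m} | in_weyl (config_of g))
     \det (\matrix_(i, j) trans lam t (x i) (config_of g j)) *
     hfun lam (config_of g))
    @[m --> \oo] --> hfun lam x.
Proof.
move=> xw; rewrite hfun_det // -(det_expgen_phi lam_gt0 t).
under eq_fun do rewrite sum_KM_box.
apply: cvg_det => i j; under eq_fun do rewrite mxE; rewrite mxE.
by apply: (cvg_sum_trans lam_abs) (phi_growth j); rewrite ler1n.
Qed.

Lemma det_trans_bounded n t (x : config n) : exists2 C, 0 <= C &
  forall y : config n,
    `|\det (\matrix_(i, j) trans lam t (x i) (y j))| <= C * \prod_j 8 ^- y j.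
Proof.
pose E : R := expR (`|t| * (M * (8 + 1))).
pose K := \sum_i E * 8 ^+ x i.
have E0 i : 0 <= E * 8 ^+ x i by rewrite mulr_ge0 ?exprn_ge0 ?expR_ge0.
exists (n`!%:R * \prod_(j < n) K).
  by rewrite mulr_ge0 // prodr_ge0 // => _ _; apply: sumr_ge0.
move=> y; rewrite -mulrA -big_split /=; apply: det_bounded_cols => i j; rewrite mxE.
rewrite (le_trans (trans_bounded lam_abs t (x i) (y j) (K := 8) _)) //.
by rewrite ler_wpM2r ?invr_ge0 ?exprn_ge0 // /K (bigD1 i) //= lerDl sumr_ge0.
Qed.

Lemma KM_harmonic n : positive_harmonic (@KM R lam n.+1) (@h1 R lam n.+1).
Proof.
split=> [x|t t0 x]; first exact: (hfun_gt0 lam_gt0 (valP x)).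
pose u (y : config n.+1) :=
  \det (\matrix_(i, j) trans lam t (val x i) (y j)) * hfun lam y.
have [C C0 detC] := det_trans_bounded t (val x).
have [B B0 hB] := hfun_bounded lam_gt0 c_gt0 lamc n.
apply: (@has_sum_sig R (config n.+1) (@in_weyl n.+1) u _ (C * B * 2 ^+ n.+1) nat
  (fun m => {ffun 'I_n.+1 -> 'I_m} : finType) (@config_of n.+1)).
- exact: config_of_inj.
- move=> m.
  have box := ler_wpM2l (mulr_ge0 C0 B0) (sum_half_powers_box R n.+1 m).
  rewrite (le_trans _ box) //.
  rewrite mulr_sumr [leRHS](bigID (fun g => in_weyl (config_of g))) /=.
  rewrite -[leLHS]addr0 lerD //; last first.
    apply: sumr_ge0 => g _; apply: mulr_ge0; first exact: mulr_ge0.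
    by apply: prodr_ge0 => i _; rewrite exprn_ge0 // invr_ge0.
  apply: ler_sum => g gw; rewrite normrM.
  rewrite (le_trans (ler_pM _ _ (detC _) (hB _ gw))) //.
  rewrite mulrACA ler_wpM2l ?mulr_ge0 // -big_split ler_prod //= => i _.
  (* Here both exponents agree, and one of the two resulting powers of one half is dropped. *)
  rewrite mulr_ge0 ?invr_ge0 ?exprn_ge0 //= (le_trans (half_power_le (leqnn _))) //.
  rewrite ffunE ler_piMr ?exprn_ge0 ?invr_ge0 // exprn_ile1 ?invr_ge0 //.
  by rewrite invf_le1 ?ler1n.
- move=> D eps eps0; have [m0 Dm0] := config_fset_bounded D.
  have := cvg_sum_KM_box t (valP x) => /cvgrPdist_lt/(_ _ eps0)[m1 _ close].
  exists (maxn m0 m1); split.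
    move=> y yD; apply: config_ofP => i.
    exact: leq_trans (Dm0 y yD i) (leq_maxl _ _).
  by rewrite distrC; apply: close; rewrite /= leq_maxr.
Qed.

(** * Summation of the two-level kernel over x' *)

Section FixedStart.
Variables (n : nat) (t : R) (y : config n) (x : config n.+1).

Definition two_level_det (y' : config n) (x' : config n.+1) : R :=
  \det (block_mx (blockA lam t x x') (blockB lam t x y')
                 (blockC lam t y x') (blockD lam t y y')).

(* Column of the block matrix attached to a value [k] of a coordinate of [x'].
   The lower half is [blockC], since there the backward difference of the
   cumulative function is minus the transition probability. *)
Definition left_column (k : nat) : 'cV[R]_(n.+1 + n) :=
  col_mx (\col_i trans lam t (x i) k)
         (\col_i - gen lam (fun u => trans lam t u k) (y i)).

Definition right_columns (y' : config n) : 'M[R]_(n.+1 + n, n) :=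
  col_mx (blockB lam t x y') (blockD lam t y y').

Lemma nablaM_cumul u k :
  nablaM (fun v => cumul lam t u v) k%:Z = - trans lam t u k.
Proof.
rewrite /nablaM; case: k => [|k].
  (* At 0 the backward difference uses the value 0 of the cumulative function at -1. *)
  have -> : 0%:Z - 1 = Negz 0 by [].
  by rewrite /cumul big_nat1 sub0r.
have -> : (k.+1%:Z - 1 = k%:Z)%R by rewrite -addn1 PoszD addrK.
by rewrite /cumul [X in _ - X]big_nat_recr //= opprD addrA subrr sub0r.
Qed.

Lemma two_level_detE y' x' :
  two_level_det y' x' =
  \det (row_mx (\matrix_(i, j) left_column (x' j) i 0) (right_columns y')).
Proof.
rewrite /two_level_det block_mxEh; congr (\det (row_mx _ _)).
apply/matrixP => i j; rewrite !mxE; case: splitP => k _; rewrite !mxE //.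
rewrite /gen /nablaP !nablaM_cumul; ring.
Qed.

Definition left_sum (b : nat) := \sum_(k < b) left_column k.

(* Limit of [left_sum b] as [b] grows: the total mass of the chain is 1. *)
Definition left_total : 'cV[R]_(n.+1 + n) := col_mx (const_mx 1) 0.

Lemma left_sumE b : left_sum b =
  col_mx (\col_i \sum_(k < b) trans lam t (x i) k)
   (\col_i - (lam (y i) * (\sum_(k < b) trans lam t (y i).+1 k -
                          \sum_(k < b) trans lam t (y i) k))).
Proof.
elim: b => [|b IHb].
  rewrite /left_sum big_ord0; apply/matrixP => i j.
  rewrite !mxE; case: splitP => k _; rewrite !mxE !big_ord0 //.
  by rewrite subrr mulr0 oppr0.
rewrite /left_sum big_ord_recr /= -/(left_sum b) IHb add_col_mx; congr col_mx;
  apply/matrixP => i j; rewrite !mxE ?big_ord_recr //=.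
by rewrite /gen /nablaP; ring.
Qed.

Lemma expgen_one u : expgen lam t (fun=> 1) u = 1.
Proof.
have := expgen_phi lam_gt0 0 t u.
by rewrite big_ord_recl big_ord0 /= expr0 fact0 divr1 mul1r addr0.
Qed.

Lemma cvg_mass u : \sum_(k < m) trans lam t u k @[m --> \oo] --> (1 : R).
Proof.
have g1 : exp_growth 1 (fun=> 1 : R) by exists 1 => z; rewrite normr1 expr1n mul1r.
have := cvg_sum_trans lam_abs (lexx 1) g1 (t := t) (x := u).
rewrite expgen_one; apply: cvg_trans; apply: near_eq_cvg; apply: nearW => m.
by apply: eq_bigr => k _; rewrite mulr1.
Qed.

Lemma cvg_left_sum i : left_sum m i 0 @[m --> \oo] --> left_total i 0.
Proof.
under eq_fun do rewrite left_sumE mxE; rewrite mxE.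
case: splitP => k _.
  under eq_fun do rewrite mxE; rewrite mxE; exact: cvg_mass.
under eq_fun do rewrite mxE; rewrite mxE.
have mass0 : - (lam (y k) * (\sum_(z < m) trans lam t (y k).+1 z -
     \sum_(z < m) trans lam t (y k) z)) @[m --> \oo] -->
     (- (lam (y k) * (1 - 1)) : R).
  by apply: cvgN; apply: cvgMl_tmp; apply: cvgB; apply: cvg_mass.
by move: mass0; rewrite subrr mulr0 oppr0.
Qed.

(** The forward equation turns the lower half into a multiple of a column of [blockD], and the upper
    half is the cumulative function of [blockB]; this is the source of the cancelling column
    operations. *)
Lemma left_sumS b : left_sum b.+1 =
  col_mx (\col_i cumul lam t (x i) b%:Z) (\col_i (lam b * trans lam t (y i) b)).
Proof.
have cE u : \sum_(k < b.+1) trans lam t u k = cumul lam t u b%:Z.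
  by rewrite /cumul big_mkord.
rewrite left_sumE; congr col_mx; apply/matrixP => i j; rewrite !mxE !cE //.
by have := gen_cumul lam_abs t (y i) b; rewrite /gen /nablaP => ->; rewrite opprK.
Qed.

(** Each slot ends where the next one starts, so the slot sums are the differences of consecutive
    tails; the last slot is itself a tail. *)
Definition left_tails (y' : config n) : 'M[R]_(n.+1 + n, n.+1) :=
  \matrix_(i, j) (left_total i 0 - left_sum (slot_start y' j) i 0).

Lemma left_tailsE y' i j :
  left_tails y' i j = left_total i 0 - left_sum (slot_start y' j) i 0.
Proof. by rewrite mxE. Qed.

Lemma left_tails_bidiag m y' i j :
  (left_tails y' *m bidiag R n.+1) i j =
  (if unlift ord_max j is Some _ then left_sum (slot_end m y' j)
   else left_total) i 0
  - left_sum (slot_start y' j) i 0.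
Proof.
elim/ordS_casesr: j => [k|]; last by rewrite mul_bidiag_max unlift_none left_tailsE.
rewrite mul_bidiagS -lift_max_widen liftK lift_max_widen slot_end_widen.
rewrite !left_tailsE slot_start_lift; ring.
Qed.

Lemma cvg_left_slots y' i j : in_weyl y' ->
  (\sum_(k < m | (slot_start y' j <= k)%N && (k < slot_end m y' j)%N)
      left_column k i 0)
    @[m --> \oo] --> (left_tails y' *m bidiag R n.+1) i j.
Proof.
move=> yw.
(* From [m0] on the box contains every entry of [y'], and each slot is an interval inside it. *)
pose m0 := (\max_k y' k).+1.
have slotsE m : (m0 <= m)%N ->
    \sum_(k < m | (slot_start y' j <= k)%N && (k < slot_end m y' j)%N)
      left_column k i 0 =
    left_sum (slot_end m y' j) i 0 - left_sum (slot_start y' j) i 0.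
  move=> m0m; have ym k : (y' k < m)%N.
    by apply: leq_trans m0m; rewrite ltnS leq_bigmax.
  rewrite (sum_ord_interval (fun k => left_column k i 0)) ?slot_end_le //;
    last exact: slot_start_end.
  by rewrite /left_sum !summxE.
(* The cutoff 0 is arbitrary: it could affect only the last slot, where [left_total] stands
   instead. *)
rewrite (left_tails_bidiag 0).
suff: left_sum (slot_end m y' j) i 0 - left_sum (slot_start y' j) i 0
    @[m --> \oo] -->
  (if unlift ord_max j is Some _ then left_sum (slot_end 0 y' j)
   else left_total) i 0
  - left_sum (slot_start y' j) i 0.
  apply: cvg_trans; apply: near_eq_cvg; exists m0 => // m m0m; exact/esym/slotsE.
apply: cvgB; last exact: cvg_cst.
elim/ordS_casesr: j {slotsE} => [k|].
  rewrite -lift_max_widen liftK lift_max_widen.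
  under eq_fun do rewrite slot_end_widen; rewrite slot_end_widen; exact: cvg_cst.
by rewrite unlift_none; under eq_fun do rewrite slot_end_max; exact: cvg_left_sum.
Qed.

Lemma det_left_tails y' :
  \det (row_mx (left_tails y' *m bidiag R n.+1) (right_columns y')) =
  \det (blockD lam t y y').
Proof.
pose T : 'M[R]_n.+1 := usubmx (left_tails y').
pose C : 'M[R]_(n, n.+1) := dsubmx (left_tails y').
have Tl i j : T i (lift ord0 j) = 1 - cumul lam t (x i) (y' j)%:Z.
  by rewrite mxE left_tailsE slot_start_lift left_sumS !col_mxEu !mxE.
have T0 i : T i ord0 = 1.
  by rewrite mxE left_tailsE slot_start0 /left_sum big_ord0 col_mxEu !mxE subr0.
have Cl i j : C i (lift ord0 j) = - (lam (y' j) * blockD lam t y y' i j).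
  by rewrite mxE left_tailsE slot_start_lift left_sumS !col_mxEd !mxE sub0r.
have C0 i : C i ord0 = 0.
  by rewrite mxE left_tailsE slot_start0 /left_sum big_ord0 col_mxEd !mxE subr0.
have lam_neq0 j : lam (y' j) != 0 by rewrite gt_eqF.
have BE : \matrix_(i, j) ((lam (y' j))^-1 *
      (1 - T i (lift ord0 j) - (i <= j)%N%:R)) =
    blockB lam t x y'.
  by apply/matrixP => i j; rewrite mxE [RHS]mxE Tl subKr.
rewrite -(det_telescoped_block lam_neq0 T0 C0 Cl) BE block_mxEh.
by rewrite -mul_col_mx vsubmxK.
Qed.

(** Over a box the sum is a single determinant whose left columns are slot sums; its entries
    converge as the box grows. *)
Lemma cvg_sum_two_level y' : in_weyl y' ->
  (\sum_(g : {ffun 'I_n.+1 -> 'I_m} | interlace y' (config_of g))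
     two_level_det y' (config_of g)) @[m --> \oo] --> \det (blockD lam t y y').
Proof.
move=> yw; rewrite -det_left_tails.
have sumE m : \sum_(g : {ffun 'I_n.+1 -> 'I_m} | interlace y' (config_of g))
     two_level_det y' (config_of g) =
   \det (row_mx (\matrix_(i, j) \sum_(k < m | (slot_start y' j <= k)%N &&
           (k < slot_end m y' j)%N) left_column k i 0) (right_columns y')).
  rewrite -(@det_row_mx_sum _ n.+1 n _ (fun j (k : 'I_m) =>
           (slot_start y' j <= k)%N &&
           (k < slot_end m y' j)%N) (fun (k : 'I_m) i => left_column k i 0)).
  apply: eq_big => [g|g _]; first exact: interlace_slots.
  rewrite two_level_detE.
  have -> : \matrix_(i, j) left_column (config_of g j) i 0 =
      \matrix_(i < n.+1 + n, j < n.+1) left_column (g j) i 0; last by [].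
  by apply/matrixP => i j; rewrite !mxE ffunE.
under eq_fun do rewrite sumE.
apply: cvg_det => i j; rewrite [X in _ --> X]mxE; under eq_fun do rewrite mxE.
case: splitP => k _; last exact: cvg_cst.
by under eq_fun do rewrite mxE; exact: cvg_left_slots.
Qed.

Lemma left_column_bounded : exists2 C, 0 <= C &
  forall i k, `|left_column k i 0| <= C * 8 ^- k.
Proof.
pose E : R := expR (`|t| * (M * (8 + 1))).
have E0 u : 0 <= E * 8 ^+ u by rewrite mulr_ge0 ?exprn_ge0 ?expR_ge0.
have M0 : 0 <= M by apply: le_trans (lam_abs 0).
have trE u k : `|trans lam t u k| <= E * 8 ^+ u * 8 ^- k.
  exact: (trans_bounded lam_abs t u k (K := 8)).
pose C1 := \sum_i E * 8 ^+ x i.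
pose C2 := \sum_i M * (E * 8 ^+ (y i).+1 + E * 8 ^+ y i).
have C10 : 0 <= C1 by apply: sumr_ge0.
have C20 : 0 <= C2 by apply: sumr_ge0 => i _; rewrite mulr_ge0 ?addr_ge0.
have p8 k : 0 <= 8 ^- k :> R by rewrite invr_ge0 exprn_ge0.
exists (C1 + C2) => [|i k]; first exact: addr_ge0.
rewrite mxE; case: splitP => l _; rewrite mxE.
  rewrite (le_trans (trE _ _)) // ler_wpM2r //.
  by rewrite /C1 (bigD1 l) //= -addrA lerDl addr_ge0 // sumr_ge0.
rewrite normrN normrM.
rewrite (@le_trans _ _ (M * (E * 8 ^+ (y l).+1 + E * 8 ^+ y l) * 8 ^- k)) //.
  rewrite -mulrA ler_pM // mulrDl (le_trans (ler_normB _ _)) // lerD //.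
rewrite ler_wpM2r // /C2 (bigD1 l) //= addrCA lerDl addr_ge0 // sumr_ge0 // => i0 _.
by rewrite mulr_ge0 ?addr_ge0.
Qed.

Lemma right_columns_bounded : exists2 C, 0 <= C &
  forall y' i j, `|right_columns y' i j| <= C.
Proof.
pose E : R := expR (`|t| * (M * (1 + 1))).
have E0 : 0 <= E by apply: expR_ge0.
exists (c^-1 * (E + 1) + E) => [|y' i j].
  by rewrite addr_ge0 // mulr_ge0 ?addr_ge0 // invr_ge0 ltW.
rewrite mxE; case: splitP => l _; rewrite mxE.
  rewrite normrM (@le_trans _ _ (c^-1 * (E + 1))) ?lerDl //.
  apply: ler_pM => //; first by rewrite gtr0_norm ?invr_gt0 // lef_pV2 ?posrE.
  rewrite (le_trans (ler_normB _ _)) // lerD //; first exact: cumul_bounded.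
  by rewrite normr_nat lern1 leq_b1.
rewrite (le_trans (trans_bounded lam_abs t (y l) (y' j) ltr01)) //.
rewrite !expr1n invr1 !mulr1 lerDr // mulr_ge0 ?addr_ge0 // invr_ge0 ltW //.
Qed.

(** The left columns decay in the entries of [x'], while the right ones are bounded uniformly in
    [y']; decay in [y'] comes later from interlacing. *)
Lemma two_level_det_bounded : exists2 C, 0 <= C &
  forall y' x', `|two_level_det y' x'| <= C * \prod_j 8 ^- x' j.
Proof.
have [C1 C10 H1] := left_column_bounded.
have [C2 C20 H2] := right_columns_bounded.
exists ((n.+1 + n)`!%:R * (\prod_(j < n.+1) C1 * \prod_(j < n) C2)).
  by rewrite mulr_ge0 // mulr_ge0 // prodr_ge0.
move=> y' x'; rewrite two_level_detE.
pose b (j : 'I_(n.+1 + n)) :=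
  match fintype.split j with inl k => C1 * 8 ^- x' k | inr k => C2 end.
have bl k : b (lshift n k) = C1 * 8 ^- x' k by rewrite /b (unsplitK (inl k)).
have br k : b (rshift n.+1 k) = C2 by rewrite /b (unsplitK (inr k)).
have entry i j : `|row_mx (\matrix_(i, j) left_column (x' j) i 0)
    (right_columns y') i j| <= b j.
  rewrite -(splitK j); case: (fintype.split j) => k /=.
    by rewrite row_mxEl bl mxE; apply: H1.
  by rewrite row_mxEr br; apply: H2.
rewrite (le_trans (det_bounded_cols entry)) // big_split_ord /=.
under eq_bigr do rewrite bl; under [X in _ * (_ * X)]eq_bigr do rewrite br.
by rewrite big_split /= -!mulrA [X in _ * (_ * X)]mulrC.
Qed.

End FixedStart.

(** Each y_i is paired with x_(i+1) > y_i, whose decay absorbs the growth in y_i; the first entry of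
    [x] stays unpaired. *)
Lemma interlace_half_powers n (y : config n) (x : config n.+1) : interlace y x ->
  (\prod_j 8 ^- x j) * \prod_i 2 ^+ y i <=
  (\prod_j 2^-1 ^+ x j) * \prod_i 2^-1 ^+ y i :> R.
Proof.
move=> /interlaceP yx.
rewrite 2![\prod_(j < n.+1) _]big_ord_recl /= -!mulrA -!big_split /=.
have p2 k : 0 <= 2^-1 ^+ k :> R by rewrite exprn_ge0 // invr_ge0.
have p8 k : 0 <= 8 ^- k :> R by rewrite invr_ge0 exprn_ge0.
apply: ler_pM => //.
- by apply: prodr_ge0 => i _; rewrite mulr_ge0 ?exprn_ge0.
- by have := half_power_le (leq0n (x ord0)); rewrite !expr0 !mulr1.
apply: ler_prod => i _; rewrite mulr_ge0 ?exprn_ge0 //=.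
by apply: half_power_le; have [_ /ltnW] := yx i.
Qed.

Lemma Ukernel_harmonic n : positive_harmonic (@Ukernel R lam n.+1) (@h2 R lam n.+1).
Proof.
split=> [[[y x] /= yx]|t t0 [[y x] yx]].
  exact/(hfun_gt0 lam_gt0)/(interlace_weyl yx).
have yw : in_weyl y := interlace_weyl yx.
pose u (z : config n.+1 * config n.+2) :=
  two_level_det t y x z.1 z.2 * hfun lam z.1.
have [C C0 detC] := two_level_det_bounded t y x.
have [B B0 hB] := hfun_bounded lam_gt0 c_gt0 lamc n.
have -> : (fun z' => Ukernel lam t (exist _ (y, x) yx) z' * h2 lam z') =
    (fun z' : weyl2 n.+1 => u (val z')).
  by apply/funext => -[[y' x'] y'x'].
(* The cutoffs for y' and x' are independent. *)
pose J (k : nat * nat) : finType :=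
  ({ffun 'I_n.+1 -> 'I_k.1} * {ffun 'I_n.+2 -> 'I_k.2})%type.
pose e (k : nat * nat) (g : J k) := (config_of g.1, config_of g.2).
apply: (@has_sum_sig R _ (fun z : config n.+1 * config n.+2 => interlace z.1 z.2)
  u _ (C * B * (2 ^+ n.+2 * 2 ^+ n.+1)) (nat * nat)%type J e).
- move=> k [g1 g2] [h1 h2] /= [E1 E2].
  by rewrite (config_of_inj E1) (config_of_inj E2).
- move=> k.
  pose w (g : J k) : R := (\prod_j 2^-1 ^+ g.2 j) * \prod_i 2^-1 ^+ g.1 i.
  have w0 g : 0 <= w g.
    by rewrite mulr_ge0 // prodr_ge0 // => i _; rewrite exprn_ge0 // invr_ge0.
  apply: (@le_trans _ _ (C * B * \sum_g w g)).
    rewrite mulr_sumr [leRHS](bigID (fun g => interlace (e k g).1 (e k g).2)) /=.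
    rewrite -[leLHS]addr0 lerD //; last first.
      by apply: sumr_ge0 => g _; apply: mulr_ge0 => //; apply: mulr_ge0.
    apply: ler_sum => g gi; rewrite normrM.
    rewrite (le_trans (ler_pM _ _ (detC _ _) (hB _ (interlace_weyl gi)))) //.
    rewrite mulrACA ler_wpM2l ?mulr_ge0 // (le_trans (interlace_half_powers gi)) //.
    rewrite /w; under eq_bigr do rewrite ffunE.
    by under [X in _ * X]eq_bigr do rewrite ffunE.
  rewrite ler_wpM2l ?mulr_ge0 //.
  have -> : \sum_g w g = \sum_(g2 : {ffun 'I_n.+2 -> 'I_k.2}) \prod_j 2^-1 ^+ g2 j *
      \sum_(g1 : {ffun 'I_n.+1 -> 'I_k.1}) \prod_i 2^-1 ^+ g1 i.
    transitivity (\sum_(g1 : {ffun 'I_n.+1 -> 'I_k.1})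
        \sum_(g2 : {ffun 'I_n.+2 -> 'I_k.2})
        (\prod_j 2^-1 ^+ g2 j) * \prod_i (2^-1 : R) ^+ g1 i).
      by rewrite pair_bigA.
    by rewrite exchange_big; apply: eq_bigr => g2 _; rewrite mulr_sumr.
  rewrite -mulr_suml ler_pM ?sum_half_powers_box //.
  + by do 2?[apply: sumr_ge0 => ? _ || apply: prodr_ge0 => ? _];
      rewrite exprn_ge0 // invr_ge0.
  + by do 2?[apply: sumr_ge0 => ? _ || apply: prodr_ge0 => ? _];
      rewrite exprn_ge0 // invr_ge0.
- move=> D eps eps0.
  have eps20 : 0 < eps / 2 by rewrite divr_gt0.
  have [a0 Da0] := config_fset_bounded [fset z.1 | z in D]%fset.
  have [b0 Db0] := config_fset_bounded [fset z.2 | z in D]%fset.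
  have := cvg_sum_KM_box t yw.
  move=> /cvgrPdist_lt/(_ _ eps20)[a1 _ closea].
  pose a := maxn a0 a1.
  pose inner b (g1 : {ffun 'I_n.+1 -> 'I_a}) :=
    \sum_(g2 : {ffun 'I_n.+2 -> 'I_b} | interlace (config_of g1) (config_of g2))
      two_level_det t y x (config_of g1) (config_of g2).
  (* [b] is chosen after [a], so that the sum over [x'] may be taken first. *)
  have limb : (\sum_(g1 : {ffun 'I_n.+1 -> 'I_a} | in_weyl (config_of g1))
      inner b g1 * hfun lam (config_of g1)) @[b --> \oo] -->
      \sum_(g1 : {ffun 'I_n.+1 -> 'I_a} | in_weyl (config_of g1))
        \det (blockD lam t y (config_of g1)) * hfun lam (config_of g1).
    apply: (cvg_big add_continuous) => g1 g1w.
    by apply: cvgMr_tmp; apply: cvg_sum_two_level.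
  have := limb => /cvgrPdist_lt/(_ _ eps20)[b1 _ closeb].
  pose b := maxn b0 b1.
  exists (a, b); split.
    move=> [y' x'] zD.
    have [g1 g1E] : exists g1 : {ffun 'I_n.+1 -> 'I_a}, config_of g1 = y'.
      apply: config_ofP => i; apply: leq_trans (leq_maxl _ _).
      exact: (Da0 _ (in_imfset _ (fun z => z.1) zD)).
    have [g2 g2E] : exists g2 : {ffun 'I_n.+2 -> 'I_b}, config_of g2 = x'.
      apply: config_ofP => i; apply: leq_trans (leq_maxl _ _).
      exact: (Db0 _ (in_imfset _ (fun z => z.2) zD)).
    by exists (g1, g2); rewrite /e /= g1E g2E.
  have -> : \sum_(j : J (a, b) | interlace (e (a, b) j).1 (e (a, b) j).2)
      u (e (a, b) j) =
     \sum_(g1 : {ffun 'I_n.+1 -> 'I_a} | in_weyl (config_of g1))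
      inner b g1 * hfun lam (config_of g1).
    transitivity (\sum_(g1 : {ffun 'I_n.+1 -> 'I_a})
        \sum_(g2 : {ffun 'I_n.+2 -> 'I_b} | interlace (config_of g1) (config_of g2))
          two_level_det t y x (config_of g1) (config_of g2) *
          hfun lam (config_of g1)).
      by rewrite pair_big_dep.
    rewrite [RHS]big_mkcond; apply: eq_bigr => g1 _.
    case: ifPn => [_|g1w]; first by rewrite mulr_suml.
    (* A y' outside the Weyl chamber interlaces with no x', so its inner sum is empty. *)
    by rewrite big_pred0 // => g2; apply: contraNF g1w; apply: interlace_weyl.
  rewrite -normrN opprB (splitr eps).
  have := closea a (leq_maxr _ _); have := closeb b (leq_maxr _ _).
  move=> hb ha; apply: le_lt_trans (ler_distD _ _ _) (ltrD ha hb).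
Qed.

End Kernels.

Theorem proposition2p18 (R : realType) (lam : nat -> R)
  (lam_pos : forall x, 0 < lam x)
  (lam_inf : (0 < ereal_inf (range (fun x => (lam x)%:E)))%E)
  (lam_sup : (ereal_sup (range (fun x => (lam x)%:E)) < +oo)%E)
  (N : nat) (N_ge1 : (1 <= N)%N) :
  positive_harmonic (@KM R lam N) (@h1 R lam N) /\
  positive_harmonic (@Ukernel R lam N) (@h2 R lam N).
Proof.
(* The infimum is a real number: positivity excludes -oo, and the finite value at 0 excludes +oo. *)
have [c c_gt0 lamc] : exists2 c, 0 < c & forall x, c <= lam x.
  have inf_le x : (ereal_inf (range (fun x => (lam x)%:E)) <= (lam x)%:E)%E.
    by apply: ereal_inf_lbound; exists x.
  move: lam_inf inf_le; case: ereal_inf => [c||] //.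
    by rewrite lte_fin => c0 cle; exists c => // x; rewrite -lee_fin.
  by move=> _ /(_ 0%N).
have [M lamM] : exists M, forall x, lam x <= M.
  have le_sup x : ((lam x)%:E <= ereal_sup (range (fun x => (lam x)%:E)))%E.
    by apply: ereal_sup_ubound; exists x.
  move: lam_sup le_sup; case: ereal_sup => [M||] //.
    by move=> _ leM; exists M => x; rewrite -lee_fin.
  by move=> _ /(_ 0%N).
case: N N_ge1 => // n _; split.
  exact: KM_harmonic lam_pos c_gt0 lamc lamM n.
exact: Ukernel_harmonic lam_pos c_gt0 lamc lamM n.
Qed.
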